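(* Let $\mathbb{F}_q$ be the finite field of $q$ elements and let $p$ be its characteristic. For any integer $k$ with $p > k \ge 3$ and any two sets $\mathcal{A}, \mathcal{B} \subseteq \mathbb{F}_q$ with $$ \#\mathcal{A}\,\#\mathcal{B} \ge (k-1)^{2/(k-1)}\, q^{2 - 1/(k-1)}, $$ the productset $\mathcal{A}\mathcal{B}$ contains a $k$-term arithmetic progression.
   Context: For $\mathcal{A}, \mathcal{B} \subseteq \mathbb{F}_q$, the productset is $\mathcal{A}\mathcal{B} = \{ab : a \in \mathcal{A},\ b \in \mathcal{B}\}$, and $\#\mathcal{A}$ denotes the cardinality of $\mathcal{A}$. A $k$-term arithmetic progression (an arithmetic progression of length $k$) in $\mathbb{F}_q$ consists of elements $\lambda + j\mu$, $j = 0, \ldots, k-1$, with $\lambda \in \mathbb{F}_q$ and $\mu \in \mathbb{F}_q^*$, where $\mathbb{F}_q^* = \mathbb{F}_q \setminus \{0\}$. *)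

(* Defs.v *)
From mathcomp Require Import all_boot all_order all_algebra.

Set Implicit Arguments.
Unset Strict Implicit.
Unset Printing Implicit Defensive.

Import GRing.Theory.
Local Open Scope ring_scope.

Definition productset (F : finFieldType) (A B : {set F}) : {set F} :=
  [set a * b | a in A, b in B].

(* The k terms need not be assumed distinct: they are as soon as k is at most
   the characteristic of F. *)
Definition contains_AP (F : finFieldType) (k : nat) (S : {set F}) : Prop :=
  exists lambda mu : F,
    mu != 0 /\ forall j : nat, (j < k)%N -> lambda + mu *+ j \in S.

(* Main.v *)
(* Fix a nonzero product x0 = a0 b0 and look for progressions x0 (1 + j x), j < k,
   with x <> 0.  Expanding the condition x0 (1 + j x) \in AB, 1 <= j < k, in
   multiplicative characters gives a main term of size (#A #B)^(k-1) q, and error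
   terms controlled by Weil's bound for sum_x prod_j chi_j (z_j - x) together with
   Parseval and Cauchy-Schwarz; the density hypothesis makes the main term win.

   Weil's bound is obtained elementarily.  Summing prod_j chi_j (P z_j) over the
   monic P of degree n yields the coefficients of an L-function which vanish for
   n >= m (interpolation at the m nodes), and counting, for each P, the Frobenius
   orbits of its roots shows that these coefficients satisfy Newton's identities
   with the character sums over the extensions F_{q^n}.  These sums are therefore
   power sums of the m - 1 reciprocal roots.  Stepanov's polynomial method bounds
   them by O(q^{n/2}) for even n, which forces every reciprocal root to have
   modulus at most sqrt q. *)
From HB Require Import structures.
Require Import Defs.
From mathcomp Require Import all_boot all_order all_algebra.
From mathcomp Require Import reals exp.
From mathcomp Require Import all_fingroup all_solvable all_field.
From mathcomp Require Import generic_quotient complex ring zify lra.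

Set Implicit Arguments.
Unset Strict Implicit.
Unset Printing Implicit Defensive.

Import Order.TTheory GRing.Theory Num.Theory.
Local Open Scope ring_scope.

(** * Independence of the powers of f^((Q-1)/d) over polynomials in X^Q *)

(** The term j = 0 is x0 itself and lies in AB for free. A progression thus costs only K = k - 1
    conditions on the single unknown x, whence the exponent 1/(k - 1).

    Stepanov's method bounds the size of a class f^((Q-1)/d) = c only from above. Lower bounds come
    from all d classes together: they exhaust the points where f is nonzero, and the character
    values attached to them sum to 0. The method is applied to squares Q, because its parameters are
    taken proportional to sqrt Q; this loses nothing, since even power sums of the reciprocal roots
    are the power sums of their squares.

    The delicate point of the method is that the auxiliary polynomial is nonzero. Reduced modulo
    X^Q, this rests on f Y^d - c having no factor of degree strictly between 0 and d over K(X),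
    which is read off a resultant.

    The constant in the density hypothesis is exact. Removing 0 from A and B, excluding x = 0 and
    the zeros of the factors all cost lower-order terms, so the final comparison in
    [density_beats_error] cannot be asymptotic. *)

Lemma exists_kernel_vector (K : fieldType) (I J : finType) (a : I -> J -> K) :
  (#|J| < #|I|)%N ->
  exists v : I -> K, (exists i, v i != 0) /\ forall j, \sum_i v i * a i j = 0.
Proof.
move=> ltJI; pose A : 'M_(#|I|, #|J|) := \matrix_(i, j) a (enum_val i) (enum_val j).
have /rowV0Pn[u /sub_kermxP uA u0] : kermx A != 0.
  by rewrite kermx_eq0 /row_free neq_ltn (leq_ltn_trans (rank_leq_col A)).
exists (fun i => u 0 (enum_rank i)); split=> [|j].
  have /rV0Pn[i ui] := u0.
  by exists (enum_val i); rewrite enum_valK.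
have /rowP/(_ (enum_rank j)) := uA; rewrite !mxE; apply: etrans.
rewrite (reindex (@enum_val I predT)) /=; last by apply: onW_bij; apply: enum_val_bij.
by apply: eq_bigr => i _; rewrite enum_valK mxE enum_rankK.
Qed.

Lemma fracP (R : idomainType) (x : {fraction R}) :
  exists a b : R, b != 0 /\ x * FracField.tofrac b = FracField.tofrac a.
Proof.
elim/quotW: x => r.
exists (frac r).1, (frac r).2; split; first exact: denom_ratioP.
unlock FracField.tofrac.
rewrite -[X in X = _](FracField.pi_mul _ _); apply/eqmodP.
rewrite /= FracField.equivfE /FracField.mulf /=.
rewrite !numden_Ratio ?mulr1 ?oner_neq0 ?mulf_neq0 ?denom_ratioP //.
by rewrite mulrC.
Qed.

(* Multiplication by 'X on L['X] / (H) has determinant [a]. *)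
Lemma dvdp_binomial_norm (L : fieldType) (f c : L) (d : nat) (H : {poly L}) :
  (1 < size H)%N -> H %| (f *: 'X^d - c%:P) ->
  exists a : L, f ^+ (size H).-1 * a ^+ d = c ^+ (size H).-1.
Proof.
move=> H1 HP; pose H' := (lead_coef H)^-1 *: H.
have lH : lead_coef H != 0 by rewrite lead_coef_eq0 -size_poly_gt0 ltnW.
have Hm : H' \is monic by rewrite monicE lead_coefZ mulVf.
have sH : size H' = size H by rewrite size_scale ?invr_eq0.
have : H' %| (f *: 'X^d - c%:P) by rewrite dvdpZl ?invr_eq0.
rewrite -sH in H1 *; move: (H') Hm H1 => h hm h1 /dvdpP[q PG].
have [D sD] : exists D, (size h).-1 = D.+1.
  by exists (size h).-2; move: h1; case: (size h) => [|[]].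
(* Cayley-Hamilton for the companion matrix: [h], hence its multiple, vanishes at [A], which leaves
   f A^d = c to take determinants of. *)
have [A AH] : exists A : 'M[L]_D.+1, horner_mx A h = 0.
  move: (companionmxK hm); move: (companionmx h); rewrite sD => A <-.
  by exists A; apply: Cayley_Hamilton.
have := congr1 (horner_mx A) PG; rewrite rmorphM /= AH mulr0.
rewrite rmorphB /= horner_mxZ rmorphXn /= horner_mx_X horner_mx_C.
move/eqP; rewrite subr_eq0 => /eqP FA.
exists (\det A); rewrite sD.
have := congr1 determinant FA; rewrite detZ det_scalar => <-.
congr (_ * _); elim: (d) => [|n IH]; first by rewrite !expr0 det1.
by rewrite !exprS det_mulmx IH.
Qed.

(** A zero resultant would give a common factor of degree D with 0 < D < d. Its norm over the
    fraction field of K[X] makes f^D, up to a constant, the d-th power of a rational function. The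
    long hypothesis, which recurs below, says that this forces d to divide D. *)
Lemma resultant_binomial_neq0 (K : fieldType) (f : {poly K}) (d : nat) (c : K)
  (z : {poly {poly K}}) :
  (0 < d)%N -> f != 0 -> c != 0 ->
  (forall D (a b : {poly K}) (u : K), a != 0 -> b != 0 -> u != 0 ->
     a ^+ d * f ^+ D = u *: b ^+ d -> (d %| D)%N) ->
  z != 0 -> (size z <= d)%N ->
  resultant (f *: 'X^d - c%:P%:P) z != 0.
Proof.
move=> d_gt0 f0 c0 hf z0 zd; set P := _ - _.
rewrite resultant_eq0 -leqNgt; set G := gcdp P z.
rewrite leqNgt; apply/negP => G1.
have [L [F [FI FP]]] : exists (L : fieldType) (F : {rmorphism {poly K} -> L}),
   injective F /\ forall x : L, exists a b : {poly K}, b != 0 /\ x * F b = F a.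
  exists {fraction {poly K}}, (@FracField.tofrac {poly K}); split; last exact: fracP.
  by move=> x y /eqP; rewrite tofrac_eq => /eqP.
have F0 x : (F x == 0) = (x == 0) by rewrite -(rmorph0 F) (inj_eq FI).
have Gd : (size G <= d)%N by apply: leq_trans zd; apply/dvdp_leq/dvdp_gcdr.
have /Pdiv.Idomain.dvdpP[[c1 q] /= c10 PG] : G %| P by apply: dvdp_gcdl.
have sG : size (map_poly F G) = size G by apply: size_map_inj_poly => //; exact: rmorph0.
have GP : map_poly F G %| (F f *: 'X^d - (F c%:P)%:P).
  rewrite -(@dvdpZr _ (F c1)) ?F0 // -(map_polyXn F) -(map_polyC F) -map_polyZ -rmorphB.
  by rewrite -map_polyZ PG rmorphM /= dvdp_mull.
have [|x] := dvdp_binomial_norm _ GP; rewrite sG // => xP.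
have [a [b [b0 ab]]] := FP x.
have key : a ^+ d * f ^+ (size G).-1 = c ^+ (size G).-1 *: b ^+ d.
  apply: FI; rewrite -mul_polyC polyC_exp !rmorphM !rmorphXn /= -xP /= -ab.
  by rewrite exprMn mulrC mulrA.
have cb0 : c ^+ (size G).-1 *: b ^+ d != 0.
  by rewrite scaler_eq0 !expf_eq0 (negPf c0) (negPf b0) !andbF.
have a0 : a != 0.
  by apply: contraNneq cb0 => a0; rewrite -key a0 expr0n gtn_eqF // mul0r.
have := hf _ _ _ _ a0 b0 (expf_neq0 _ c0) key.
by move=> /dvdn_leq; lia.
Qed.

Lemma size_sum_bound (R : nzRingType) (I : finType) (A : I -> {poly R}) n :
  (forall i, size (A i) <= n)%N -> (size (\sum_i A i)%R <= n)%N.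
Proof.
by move=> An; apply: leq_trans (size_sum _ _ _) _; apply/bigmax_leqP => i _.
Qed.

Lemma size_prod_bound (R : idomainType) (I : finType) (A : I -> {poly R}) (D : I -> nat) :
  (forall i, size (A i) <= (D i).+1)%N ->
  (size (\prod_i A i)%R <= (\sum_i D i).+1)%N.
Proof.
move=> AD; apply: (big_ind2 (fun (p : {poly R}) n => (size p <= n.+1)%N)) => [|p u q v pu qv|//].
  by rewrite size_poly1.
by apply: leq_trans (size_polyMleq _ _) _; lia.
Qed.

Lemma size_det_bound (R : idomainType) n (A : 'M[{poly R}]_n) (D : 'I_n -> nat) :
  (forall i j, size (A i j) <= (D i).+1)%N ->
  (size (\det A) <= (\sum_i D i).+1)%N.
Proof.
move=> AD; apply: size_sum_bound => s.
by rewrite -signr_odd; case: odd; rewrite ?expr0 ?expr1 ?mul1r ?mulN1r ?size_polyN;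
  apply: size_prod_bound => i; apply: AD.
Qed.

(** Each term of the determinant takes one entry from each row of the Sylvester matrix:
    [(size q).-1] rows are filled from [p] and [(size p).-1] rows from [q]. *)
Lemma size_resultant_bound (R : idomainType) (p q : {poly {poly R}}) (m T : nat) :
  (forall i, size (p`_i)%R <= m.+1)%N -> (forall i, size (q`_i)%R <= T.+1)%N ->
  (size (resultant p q) <= ((size q).-1 * m + (size p).-1 * T).+1)%N.
Proof.
move=> pm qT; pose D (i : 'I_((size q).-1 + (size p).-1)) :=
  if split i is inl _ then m else T.
have AD i j : (size (Sylvester_mx p q i j)%R <= (D i).+1)%N.
  rewrite Sylvester_mxE /D.
  by case: split => l; case: (l <= j)%N; rewrite ?mulr1n ?mulr0n ?size_poly0.
apply: leq_trans (size_det_bound AD) _; rewrite ltnS big_split_ord /=.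
rewrite (eq_bigr (fun=> m)) => [|i _]; last first.
  by rewrite /D (unsplitK (inl i)).
rewrite [X in (_ + X)%N](eq_bigr (fun=> T)) => [|i _]; last first.
  by rewrite /D (unsplitK (inr i)).
by rewrite !sum_nat_const !card_ord.
Qed.

(* [g] is a root modulo 'X^Q of [f Y^d - c].  The resultant of this polynomial with
   [\sum_i k_i Y^i] is thus divisible by 'X^Q, although it is nonzero and its
   degree is too small. *)
Lemma independent_powers_mod_Xn (K : fieldType) (f g : {poly K}) (d m T Q : nat)
    (c : K) (k : 'I_d -> {poly K}) :
  (0 < d)%N -> c != 0 ->
  (forall D (a b : {poly K}) (u : K), a != 0 -> b != 0 -> u != 0 ->
     a ^+ d * f ^+ D = u *: b ^+ d -> (d %| D)%N) ->
  f != 0 -> (size f <= m.+1)%N -> (forall i, size (k i) <= T.+1)%N -> (d * T + d * m < Q)%N ->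
  'X^Q %| f * g ^+ d - c%:P -> 'X^Q %| \sum_i k i * g ^+ i ->
  forall i, k i = 0.
Proof.
move=> d_gt0 c0 hf f0 fm kT dQ gd zg i; apply/eqP/negPn/negP => ki.
pose z : {poly {poly K}} := \sum_(i < d) k i *: 'X^i.
have zE (j : 'I_d) : z`_j = k j.
  rewrite coef_sum (bigD1 j) //= big1 => [|l lj]; rewrite coefZ coefXn.
    by rewrite eqxx mulr1 addr0.
  by case: eqP => [/val_inj e|_]; rewrite ?mulr0 //; rewrite e eqxx in lj.
have z0 : z != 0 by apply: contraNneq ki => z0; rewrite -zE z0 coef0.
have zd : (size z <= d)%N.
  apply: size_sum_bound => j; apply: leq_trans (size_scale_leq _ _) _.
  by rewrite size_polyXn.
have zT j : (size (z`_j)%R <= T.+1)%N.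
  have [jd|dj] := ltnP j d; first by rewrite (zE (Ordinal jd)).
  by rewrite nth_default ?size_poly0 // (leq_trans zd).
have zgE : z.[g] = \sum_i k i * g ^+ i.
  by rewrite horner_sum; apply: eq_bigr => j _; rewrite hornerZ hornerXn.
have absurd_div (N : {poly K}) : N != 0 -> (size N <= Q)%N -> 'X^Q %| N -> False.
  by move=> N0 NQ /dvdp_leq -/(_ N0); rewrite size_polyXn ltnNge NQ.
pose P : {poly {poly K}} := f *: 'X^d - c%:P%:P.
have sP : size P = d.+1.
  rewrite size_polyDl size_scale // size_polyXn // size_polyN.
  by rewrite ltnS (leq_trans (size_polyC_leq1 _)).
(* Ideal membership of the resultant asks for positive degree. A constant [z] is itself a multiple
   of X^Q that is too short. *)
have [z1|z1] := leqP (size z) 1.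
  have zC := size1_polyC z1.
  apply: (@absurd_div z`_0); last by rewrite -zgE {1}zC hornerC in zg.
    by apply: contraNneq z0 => e; rewrite zC e.
  by apply: leq_trans (zT 0%N) _; apply: leq_ltn_trans dQ; nia.
have [|//|[u v] /= _ /(congr1 (fun p => p.[g]))] := @resultant_in_ideal _ P z.
  by rewrite sP.
rewrite hornerC hornerD !hornerM zgE => res.
apply: (@absurd_div (resultant P z)).
- exact: resultant_binomial_neq0.
- apply: leq_trans (size_resultant_bound (m := m) _ zT) _ => [j|].
    rewrite coefB coefZ coefXn coefC.
    case: eqP => _; case: eqP => _; rewrite ?mulr1 ?mulr0 ?subr0 ?sub0r ?size_polyN ?size_poly0 //.
    + apply: leq_trans (size_polyD _ _) _; rewrite geq_max fm size_polyN.
      by rewrite (leq_trans (size_polyC_leq1 _)).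
    + by rewrite (leq_trans (size_polyC_leq1 _)).
  have : ((size z).-1 * m <= d * m)%N by rewrite leq_mul2r; apply/orP; right; lia.
  by rewrite sP /= => h; apply: leq_ltn_trans dQ; rewrite addnC leq_add2l.
- rewrite res; rewrite dvdp_add ?dvdp_mull //.
  by rewrite /P hornerD hornerN hornerZ hornerXn hornerC.
Qed.

(** * Stepanov's method *)

Lemma dvdp_sum (R : idomainType) (I : Type) (r : seq I) (P : pred I) (A : I -> {poly R}) p :
  (forall i, P i -> p %| A i) -> p %| \sum_(i <- r | P i) A i.
Proof. by move=> pA; apply: (big_ind (fun q => p %| q)) => //; exact: dvdp_add. Qed.

(** Translation by a new variable is a ring morphism with the Hasse derivatives as coefficients;
    Leibniz's rule follows in any characteristic, without factorials. *)
Lemma poly_XaY_nderivn (R : comNzRingType) (p : {poly R}) n :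
  (poly_XaY p)`_n = p^`N(n).
Proof.
have XaYE : poly_XaY p = \sum_(i < size p) (p^`N(i))%:P * 'X^i.
  rewrite /poly_XaY /comp_poly addrC nderiv_taylor ?size_map_polyC; last exact: mulrC.
  apply: eq_bigr => i _; congr (_ * _).
  by rewrite !nderivn_map horner_map -/(comp_poly _ _) comp_polyXr.
rewrite XaYE coef_sum; under eq_bigr do rewrite coefCM coefXn.
have [np|pn] := ltnP n (size p).
  rewrite (bigD1 (Ordinal np)) //= eqxx mulr1 big1 ?addr0 // => i ni.
  by rewrite -val_eqE eq_sym /= in ni; rewrite (negPf ni) mulr0.
rewrite nderivn_poly0 // big1 // => i _.
by rewrite gtn_eqF ?mulr0 // (leq_trans _ pn).
Qed.

Lemma nderivnM (R : comNzRingType) (p q : {poly R}) n :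
  (p * q)^`N(n) = \sum_(i < n.+1) p^`N(i) * q^`N(n - i).
Proof.
rewrite -poly_XaY_nderivn /poly_XaY !rmorphM /= coefM.
by apply: eq_bigr => i _; rewrite !poly_XaY_nderivn.
Qed.

(** One factor [f] is split off by Leibniz's rule: either it stays underived, or it has absorbed a
    derivative and the rest loses one factor fewer. *)
Lemma dvdp_nderivn_exp (R : idomainType) (f h : {poly R}) s n :
  f ^+ (s - n) %| (h * f ^+ s)^`N(n).
Proof.
elim: s n => [|s IH] n; first by rewrite dvd1p.
have [ns|sn] := leqP n s; last by rewrite (eqP (_ : s.+1 - n == 0)%N) ?dvd1p.
rewrite exprSr mulrA nderivnM big_ord_recr /= subnn nderivn0.
rewrite subSn // exprSr dvdp_add ?dvdp_mul //.
apply: dvdp_sum => i _; apply: dvdp_mulr; apply: dvdp_trans (IH i).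
by rewrite -exprSr dvdp_exp2l //; have := ltn_ord i; lia.
Qed.

(** Taylor expansion at [a]. Iterated derivatives would not do: in characteristic p they vanish
    identically from order p on, whereas M may exceed p. *)
Lemma dvdp_XsubC_exp_nderivn (K : fieldType) (p : {poly K}) (a : K) M :
  (forall n, (n < M)%N -> p^`N(n).[a] = 0) -> ('X - a%:P) ^+ M %| p.
Proof.
move=> pa; have -> : p = \sum_(i < size p) p^`N(i).[a] *: ('X - a%:P) ^+ i.
  have := nderiv_taylor (map_poly polyC p) (mulrC a%:P ('X - a%:P)).
  rewrite addrC subrK [LHS]comp_polyXr size_map_polyC => {1}->.
  apply: eq_bigr => i _.
  by rewrite nderivn_map -mul_polyC horner_map.
apply: dvdp_sum => i _.
have [iM|Mi] := ltnP i M; first by rewrite pa // scale0r dvdp0.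
by rewrite -mul_polyC dvdp_mull // dvdp_exp2l.
Qed.

(** Modulo X^Q only the block j = 0 survives, so its coefficients vanish; dividing the rest by X^Q
    lowers J by one. *)
Lemma independent_powers (K : fieldType) (g : {poly K}) (d Q : nat) S J
    (k : nat -> 'I_d -> {poly K}) :
  (forall k : 'I_d -> {poly K}, (forall i, size (k i) <= S)%N ->
     'X^Q %| \sum_i k i * g ^+ i -> forall i, k i = 0) ->
  (forall j i, size (k j i) <= S)%N ->
  \sum_(j < J) 'X^(j * Q) * \sum_i k j i * g ^+ i = 0 ->
  forall j i, (j < J)%N -> k j i = 0.
Proof.
move=> indep; elim: J k => [//|J IH] k kS.
rewrite big_ord_recl /= mul0n expr0 mul1r => sum0.
have tailE : \sum_(j < J) 'X^(bump 0 j * Q) * \sum_i k (bump 0 j) i * g ^+ i =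
    'X^Q * \sum_(j < J) 'X^(j * Q) * \sum_i k j.+1 i * g ^+ i.
  by rewrite mulr_sumr; apply: eq_bigr => j _; rewrite /bump add1n mulSn exprD mulrA.
have k0 : forall i, k 0%N i = 0.
  apply: indep => [i|]; first exact: kS.
  move/eqP: sum0; rewrite tailE addr_eq0 => /eqP ->.
  by rewrite dvdpNr dvdp_mulIl.
move: sum0; rewrite tailE big1 => [|i _]; last by rewrite k0 mul0r.
rewrite add0r => /eqP; rewrite mulf_eq0 -size_poly_eq0 size_polyXn /= => /eqP tail0.
move=> [|j] i ltj; first exact: k0.
exact: (IH (fun j => k j.+1) (fun j => kS j.+1) tail0).
Qed.

(* The auxiliary polynomial is f^M \sum v_(i,j,t) X^t f^(e i) X^(j Q).  At a point
   [a] of [s] one has f^e = c, and X^Q agrees with [a] modulo (X - a)^M, so that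
   vanishing to order M at all of [s] costs M (T + M m + J) linear conditions on
   the d J (T + 1) unknowns. *)
Lemma stepanov_bound (K : fieldType) (f : {poly K}) (c : K) (s : seq K)
    (d e m T J M Q : nat) :
  (0 < d)%N -> f != 0 -> f.[0] != 0 -> (size f).-1 = m ->
  (forall D (a b : {poly K}) (u : K), a != 0 -> b != 0 -> u != 0 ->
     a ^+ d * f ^+ D = u *: b ^+ d -> (d %| D)%N) ->
  (d * e).+1 = Q -> 'X^Q %| f ^+ Q - (f.[0] ^+ Q)%:P -> [pchar K].-nat Q ->
  uniq s -> (forall a, a \in s -> [/\ a ^+ Q = a, f.[a] ^+ e = c & f.[a] != 0]) ->
  (M <= Q)%N -> (0 < J)%N -> (d * T + d * m < Q)%N ->
  (M * (T + M * m + J) < d * J * T.+1)%N ->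
  (M * size s <= T + m * Q + m * M + J * Q)%N.
Proof.
move=> d0 f0 f00 fm hf deQ fQ pQ us sP MQ J0 TQ cond.
have sf : size f = m.+1 by rewrite -fm prednK // size_poly_gt0.
have f0X n : f ^+ n != 0 by rewrite expf_neq0.
(* The factor f^M leaves f^(e i + M - l) in the derivative of order l < M. The cofactor [q] then has
   degree at most T + M m whatever [i], because f^(e i) is replaced by c^i instead of being
   expanded. *)
pose ex (i : 'I_d) := (i * e + M)%N.
pose q i t l := ('X^t * f ^+ ex i)^`N(l) %/ f ^+ (ex i - l).
have qE i t l : ('X^t * f ^+ ex i)^`N(l) = q i t l * f ^+ (ex i - l).
  by rewrite /q divpK // dvdp_nderivn_exp.
pose W := (T + M * m + J)%N.
have qW i (t : 'I_T.+1) (l : 'I_M) : (size (q i t l) <= T + M * m + 1)%N.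
  rewrite size_divp // size_exp sf /=.
  have sn : (size (('X^t * f ^+ ex i)^`N(l)) <= t + ex i * m + 1 - l)%N.
    apply: leq_trans (size_poly _ _) _; apply: leq_sub2r.
    apply: leq_trans (size_polyMleq _ _) _.
    rewrite size_polyXn addSn /=; have := size_exp f (ex i).
    rewrite sf /= [(m * _)%N]mulnC; move: (ex i * m)%N => B; case: (size _) => [|A] /=; lia.
  have lM := ltn_ord l; have tT := ltn_ord t.
  have exE : (ex i * m = m * (ex i - l) + l * m)%N.
    by rewrite [(m * _)%N]mulnC -mulnDl subnK // /ex; lia.
  have lm : (l * m <= M * m)%N by rewrite leq_mul2r (ltnW lM) orbT.
  rewrite leq_subLR (leq_trans sn) // exE.
  by move: (m * _)%N (l * m)%N (M * m)%N lm => B1 B2 B3 lm; lia.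
pose I := ('I_d * 'I_J * 'I_T.+1)%type; pose Eq := ('I_M * 'I_W)%type.
pose a (x : I) (y : Eq) : K := (c ^+ x.1.1 *: (q x.1.1 x.2 y.1 * 'X^(x.1.2)))`_y.2.
have [|v [[x0 vx0] vker]] := @exists_kernel_vector K I Eq a.
  by rewrite !card_prod !card_ord.
(* Vanishing is imposed on a whole polynomial for each [l], not point by point, so the number of
   equations does not depend on [s]. *)
have qker (l : 'I_M) : \sum_(x : I) v x *: (c ^+ x.1.1 *: (q x.1.1 x.2 l * 'X^(x.1.2))) = 0.
  apply/polyP => w; rewrite coef_sum coef0.
  have [wW|Ww] := ltnP w W.
    have := vker (l, Ordinal wW); apply: etrans.
    by apply: eq_bigr => x _; rewrite coefZ.
  apply: big1 => -[[i j] t] _ /=; rewrite nth_default //; apply: leq_trans Ww.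
  do 2 apply: leq_trans (size_scale_leq _ _) _.
  apply: leq_trans (size_polyMleq _ _) _; rewrite size_polyXn.
  have := qW i t l; have := ltn_ord j; rewrite /W.
  by move: (size _) (M * m)%N => B1 B2; lia.
pose R := \sum_(x : I) v x *: ('X^(x.2) * f ^+ ex x.1.1 * 'X^(x.1.2 * Q)).
have R0 : R != 0.
  apply: contraNneq vx0 => R0.
  pose k (j : nat) (i : 'I_d) : {poly K} :=
    if insub j is Some j' then \poly_(t < T.+1) (if insub t is Some t' then v (i, j', t') else 0)
    else 0.
  have kE (j : 'I_J) i : k j i = \sum_(t < T.+1) v (i, j, t) *: 'X^t.
    rewrite /k valK poly_def; apply: eq_bigr => t _.
    by rewrite valK.
  have : \sum_(j < J) 'X^(j * Q) * \sum_i k j i * (f ^+ e) ^+ i = 0.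
    apply: (mulfI (f0X M)); rewrite mulr0; apply: etrans R0; rewrite /R.
    rewrite (reindex (fun x : 'I_J * 'I_d * 'I_T.+1 => (x.1.2, x.1.1, x.2))) /=; last first.
      by exists (fun x => (x.1.2, x.1.1, x.2)) => [[[]]|[[]]].
    rewrite -(pair_bigA _ (fun x t => v (x.2, x.1, t) *: ('X^t * f ^+ ex x.2 * 'X^(x.1 * Q)))) /=.
    rewrite -(pair_bigA _ (fun j i => \sum_(t < T.+1) v (i, j, t) *: ('X^t * f ^+ ex i * 'X^(j * Q)))) /=.
    rewrite mulr_sumr; apply: eq_bigr => j _.
    rewrite mulr_sumr mulr_sumr; apply: eq_bigr => i _.
    rewrite kE mulr_suml mulr_sumr mulr_sumr; apply: eq_bigr => t _.
    rewrite -!mul_polyC /ex exprD [(i * e)%N]mulnC (exprM f).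
    by ring.
  move/(independent_powers (S := T.+1)) => kk.
  have ke : k x0.1.2 x0.1.1 = 0.
    apply: kk => [k' k'T dv i'|j i|//].
      apply: (@independent_powers_mod_Xn _ f (f ^+ e) d m T Q (f.[0] ^+ Q)) dv i' => //.
      + by rewrite expf_neq0.
      + by rewrite sf.
      + by rewrite -exprM mulnC -exprS deQ.
    rewrite /k; case: insubP => [j' _ _|_]; last by rewrite size_poly0.
    exact: size_poly.
  move: ke; rewrite kE => /polyP/(_ x0.2); rewrite coef0 => ke.
  apply/eqP; apply: etrans ke.
  rewrite coef_sum (bigD1 x0.2) //= big1 => [|t tx].
    by rewrite coefZ coefXn eqxx mulr1 addr0 -!surjective_pairing.
  by rewrite coefZ coefXn eq_sym (negPf (tx : t != x0.2 :> nat)) mulr0.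
have dvR b : b \in s -> ('X - b%:P) ^+ M %| R.
  move=> bs; have [bQ fbc fb0] := sP b bs.
  have cQ : [pchar {poly K}].-nat Q by rewrite (eq_pnat _ (pchar_poly _)).
  (* X^Q - b = (X - b)^Q by Frobenius, as b^Q = b; and M <= Q. *)
  have XQ : ('X - b%:P) ^+ M %| 'X^Q - b%:P.
    rewrite -{2}bQ polyC_exp -exprNn_pchar // -exprDn_pchar //.
    by rewrite dvdp_exp2l.
  pose Rb := \sum_(x : I) (v x * b ^+ x.1.2) *: ('X^(x.2) * f ^+ ex x.1.1).
  have -> : R = Rb + \sum_(x : I) v x *: ('X^(x.2) * f ^+ ex x.1.1 * ('X^(x.1.2 * Q) - (b ^+ x.1.2)%:P)).
    rewrite -big_split /=; apply: eq_bigr => x _.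
    by rewrite -!mul_polyC polyCM; ring.
  apply: dvdp_add; last first.
    apply: dvdp_sum => x _; rewrite -mul_polyC dvdp_mull // dvdp_mull //.
    apply: dvdp_trans XQ _; rewrite mulnC exprM polyC_exp subrXX.
    by rewrite dvdp_mulr.
  apply: dvdp_XsubC_exp_nderivn => l lM.
  (* The common factor f(b)^(M - l) is restored, and c^i turns back into f(b)^(e i). *)
  have := congr1 (fun p => (f ^+ (M - l) * p).[b]) (qker (Ordinal lM)).
  rewrite mulr0 horner0 => <-.
  rewrite /Rb raddf_sum /= mulr_sumr !horner_sum; apply: eq_bigr => x _.
  rewrite [(_ *: _)^`N(l)]nderivnZ qE !(hornerZ, hornerM, hornerXn, horner_exp).
  rewrite -fbc -exprM /ex -addnBA ?(ltnW lM) // exprD [(e * _)%N]mulnC.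
  by ring.
have dvP : \prod_(b <- s) ('X - b%:P) ^+ M %| R.
  elim: s us dvR {sP} => [|b s IH] /=; first by rewrite big_nil dvd1p.
  case/andP => bs us dvR; rewrite big_cons Gauss_dvdp.
    rewrite dvR ?mem_head //=; apply: IH => // x xs.
    by apply: dvR; rewrite inE xs orbT.
  rewrite big_seq; apply: (big_ind (fun p => coprimep _ p)) => [|p r|x xs].
  - exact: coprimep1.
  - by rewrite coprimepMr => -> ->.
  - apply: coprimep_expl; apply: coprimep_expr; apply: coprimep_XsubC2.
    by apply: contraNneq bs => /eqP; rewrite subr_eq0 => /eqP <-.
have sR := dvdp_leq R0 dvP; rewrite prodrXl in sR.
have sE := size_exp (\prod_(b <- s) ('X - b%:P)) M; rewrite size_prod_XsubC /= in sE.
suff : (size R <= T + m * Q + m * M + J * Q)%N.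
  by move=> sRT; rewrite mulnC -sE (leq_trans _ sRT) // (leq_trans (leq_pred _) sR).
apply: size_sum_bound => -[[i j] t] /=.
apply: leq_trans (size_scale_leq _ _) _; apply: leq_trans (size_polyMleq _ _) _.
have := size_polyMleq ('X^t) (f ^+ ex i); have := size_exp f (ex i).
rewrite !size_polyXn sf /= /ex mulnDr.
have ie : (m * (i * e) <= m * Q)%N.
  rewrite leq_mul2l -deQ; apply/orP; right; apply: leqW.
  by rewrite leq_mul2r (ltnW (ltn_ord i)) orbT.
have jQ : (j.+1 * Q <= J * Q)%N by rewrite leq_mul2r ltn_ord orbT.
have Q0 : (0 < Q)%N by rewrite -deQ.
have := ltn_ord t; move: ie jQ; rewrite mulSn.
move: (size _) (size _) (m * (i * e))%N (m * Q)%N (m * M)%N (j * Q)%N (J * Q)%N.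
by clear -Q0 => *; lia.
Qed.

Lemma size_fixed_points (K : fieldType) (s : seq K) Q :
  (1 < Q)%N -> uniq s -> (forall a, a \in s -> a ^+ Q = a) -> (size s <= Q)%N.
Proof.
move=> Q1 us sQ; have sP : size ('X^Q - 'X : {poly K}) = Q.+1.
  by rewrite size_polyDl size_polyXn // size_polyN size_polyX ltnS.
rewrite -ltnS -sP; apply: max_poly_roots => //.
  by rewrite -size_poly_gt0 sP.
by apply/allP => a /sQ aQ; rewrite rootE !hornerE aQ subrr.
Qed.

(** The summands serve the cases of [stepanov_estimate]: dy < u with u = 4d^2(dm + 1), the main case
    (which adds 2m + 1 to u), e < 2m, and y < d. *)
Definition stepanov_const (d m : nat) :=
  (4 * d * d * (d * m + 1) + 2 * m + 1 + d * (2 * d * m + 1) + d * d)%N.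

(** Stepanov's bound with Q = y^2, J = y, T = e - m and M slightly below dy: M #s is at most about y
    Q, so #s is at most Q/d + O(y). In the excluded cases y is bounded in terms of d and m, and #s
    <= Q suffices. *)
Lemma stepanov_estimate (K : fieldType) (f : {poly K}) (c : K) (s : seq K)
    (d e m y : nat) :
  (0 < d)%N -> (0 < e)%N -> f != 0 -> f.[0] != 0 -> (size f).-1 = m ->
  (forall D (a b : {poly K}) (u : K), a != 0 -> b != 0 -> u != 0 ->
     a ^+ d * f ^+ D = u *: b ^+ d -> (d %| D)%N) ->
  (d * e).+1 = (y ^ 2)%N -> 'X^(y ^ 2) %| f ^+ (y ^ 2) - (f.[0] ^+ (y ^ 2))%:P ->
  [pchar K].-nat (y ^ 2)%N ->
  uniq s ->
  (forall a, a \in s -> [/\ a ^+ (y ^ 2) = a, f.[a] ^+ e = c & f.[a] != 0]) ->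
  (d * size s <= y ^ 2 + stepanov_const d m * y)%N.
Proof.
move=> d0 e0 f0 f00 fm hf deQ fQ pQ us sP; set u := (4 * d * d * (d * m + 1))%N.
have Q1 : (1 < y ^ 2)%N by rewrite -deQ ltnS muln_gt0 d0.
have y0 : (0 < y)%N by move: Q1; case: (y).
have sQ : (size s <= y ^ 2)%N by apply: size_fixed_points => // a /sP[].
have triv C0 : (d * y ^ 2 <= C0 * y)%N -> (C0 <= stepanov_const d m)%N ->
    (d * size s <= y ^ 2 + stepanov_const d m * y)%N.
  move=> h1 h2; apply: leq_trans (leq_addl _ _).
  by apply: leq_trans (leq_trans h1 _); rewrite ?leq_mul2l ?leq_mul2r ?sQ ?h2 ?orbT.
have [dy|yd] := leqP d y; last first.
  apply: (triv (d * d)%N); last by rewrite /stepanov_const; lia.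
  by rewrite -mulnA leq_mul2l -mulnn leq_mul2r (ltnW yd) !orbT.
have [uy|yu] := leqP u (d * y); last first.
  apply: (triv u); last by rewrite /stepanov_const -/u; lia.
  by rewrite -mulnn mulnA leq_mul2r (ltnW yu) orbT.
have [me|em] := leqP (2 * m) e; last first.
  apply: (triv (d * (2 * d * m + 1))%N); last by rewrite /stepanov_const; lia.
  rewrite -[X in (X <= _)%N]muln1; apply: leq_mul => //.
  by rewrite leq_mul2l -deQ; apply/orP; right; nia.
(* The M(T + Mm + y) equations compete with d y (T + 1) unknowns. The deficit u T left by M = dy - u
   pays for the part M(Mm + y), at most d(dm + 1) y^2; the factor 4d in [u] comes from T >= e/2. *)
pose M := (d * y - u)%N; pose T := (e - m)%N.
have Mu : (M + u = d * y)%N by rewrite subnK.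
have Tm : (T + m = e)%N by rewrite subnK //; lia.
have MdY : (M <= d * y)%N by rewrite -Mu leq_addr.
have dyQ : (d * y <= y ^ 2)%N by rewrite -mulnn leq_mul2r dy orbT.
have uT : (d * (d * m + 1) * (y * y) <= u * T)%N.
  have -> : (u * T = d * (d * m + 1) * (4 * d * T))%N by rewrite /u; ring.
  rewrite leq_mul2l; apply/orP; right; rewrite mulnn -deQ.
  have : (d * e <= 2 * (d * T))%N by rewrite mulnCA leq_mul2l; lia.
  have : (0 < d * e)%N by rewrite muln_gt0 d0.
  by rewrite -mulnA; move: (d * e)%N (d * T)%N => A B; clear; lia.
have cond : (M * (T + M * m + y) < d * y * T.+1)%N.
  have MM : (M * (M * m + y) <= d * (d * m + 1) * (y * y))%N.
    apply: leq_trans (leq_mul MdY (_ : M * m + y <= d * y * m + y)%N) _.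
      by rewrite leq_add2r leq_mul2r MdY orbT.
    by rewrite leq_eqVlt; apply/orP; left; apply/eqP; ring.
  rewrite -addnA mulnDr mulnS -Mu mulnDl Mu.
  apply: leq_ltn_trans (leq_add (leqnn _) (leq_trans MM uT)) _.
  by rewrite -[X in (X < _)%N]add0n ltn_add2r muln_gt0 d0.
have TQ : (d * T + d * m < y ^ 2)%N by rewrite -mulnDr Tm deQ.
have MQ := leq_trans MdY dyQ.
have := @stepanov_bound K f c s d e m T y M (y ^ 2)%N d0 f0 f00 fm hf deQ fQ pQ us sP MQ y0 TQ cond.
have TQ' : (T <= y ^ 2)%N by nia.
have mM : (m * M <= m * y ^ 2)%N by rewrite leq_mul2l MQ orbT.
have us' : (u * size s <= u * y ^ 2)%N by rewrite leq_mul2l sQ orbT.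
(* The claim is multiplied by y: since dy = M + u, its left side splits into M #s, bounded by [MS],
   and u #s, at most u y^2. *)
move=> MS; rewrite -(leq_pmul2r y0) mulnDl -mulnA [(size s * y)%N]mulnC mulnA -Mu mulnDl.
apply: leq_trans (leq_add MS us') _.
have CE : ((u + 2 * m + 1) * y * y <= stepanov_const d m * y * y)%N.
  by rewrite !leq_mul2r; apply/orP; right; apply/orP; right; rewrite /stepanov_const -/u; lia.
apply: leq_trans (leq_add (leqnn _) CE); rewrite -!mulnA !mulnn.
move: (y ^ 2)%N mM TQ' => Q mM TQ'.
by clear -mM TQ'; nia.
Qed.

(** * Fixed points of powers of Frobenius *)

(** For Q a power of the characteristic, the subfield with Q elements. All extensions of the base
    field thus sit in one closed field, as lists rather than as types. *)
Definition fixed_points (K : closedFieldType) (Q : nat) : seq K :=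
  undup (sval (closed_field_poly_normal ('X^Q - 'X : {poly K}))).

Section FixedPoints.
Variables (K : closedFieldType) (Q : nat).
Hypotheses (Q_gt1 : (1 < Q)%N) (pcharQ : [pchar K].-nat Q).

Let size_XnX : size ('X^Q - 'X : {poly K}) = Q.+1.
Proof. by rewrite size_polyDl size_polyXn // size_polyN size_polyX ltnS. Qed.

Let XnXE : 'X^Q - 'X =
  \prod_(x <- sval (closed_field_poly_normal ('X^Q - 'X : {poly K}))) ('X - x%:P).
Proof.
case: closed_field_poly_normal => s /= {1}->.
rewrite lead_coefDl ?lead_coefXn ?scale1r // size_polyXn size_polyN size_polyX.
by rewrite ltnS.
Qed.

Lemma fixed_points_uniq : uniq (fixed_points K Q).
Proof. exact: undup_uniq. Qed.

Lemma mem_fixed_points x : (x \in fixed_points K Q) = (x ^+ Q == x).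
Proof.
by rewrite mem_undup -root_prod_XsubC -XnXE rootE !hornerE subr_eq0.
Qed.

(** The derivative of X^Q - X is -1, so its roots are simple. *)
Lemma size_fixed_points_eq : size (fixed_points K Q) = Q.
Proof.
rewrite /fixed_points undup_id.
  by apply: succn_inj; rewrite -(size_prod_XsubC _ id) -XnXE size_XnX.
rewrite -separable_prod_XsubC -XnXE.
rewrite unlock derivB derivXn derivX.
have [p pK pQ] : exists2 p, p \in [pchar K] & (p %| Q)%N.
  exists (pdiv Q); last exact: pdiv_dvd.
  by apply: (pnatPpi pcharQ); rewrite pi_pdiv.
rewrite -(divnK pQ) mulrnA -[_ *+ p]mulr_natr.
have -> : p%:R = 0 :> {poly K} by rewrite -polyC_natr (pcharf0 pK).
by rewrite mulr0 sub0r -[X in coprimep _ X]scaleN1r coprimepZr ?oppr_eq0 ?oner_eq0 ?coprimep1.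
Qed.

End FixedPoints.

(** * Products of linear factors and the non-power condition *)

Lemma mup_linear (K : fieldType) (x y : K) : mup x (y%:P - 'X) = (y == x).
Proof.
rewrite -[_ - _]opprB -mulN1r mupMr; first by rewrite (@mup_XsubCX _ 1); case: eqP.
by rewrite -polyCN rootC oppr_eq0 oner_eq0.
Qed.

Lemma linear_neq0 (K : fieldType) (y : K) : y%:P - 'X != 0.
Proof. by rewrite -opprB oppr_eq0 polyXsubC_eq0. Qed.

Lemma mup_exp (K : fieldType) (x : K) (p : {poly K}) n :
  p != 0 -> mup x (p ^+ n) = (n * mup x p)%N.
Proof.
move=> p0; elim: n => [|n IH]; first by rewrite expr0 mul0n mupNroot ?root1.
by rewrite exprS mupM ?expf_neq0 // IH mulSn.
Qed.

Section LinearFactors.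
Variables (K : fieldType) (m : nat) (z : 'I_m -> K) (e : 'I_m -> nat).
Hypothesis z_inj : injective z.
Let f := \prod_j ((z j)%:P - 'X) ^+ e j.

Lemma prod_linear_neq0 : f != 0.
Proof. by apply/prodf_neq0 => j _; rewrite expf_neq0 ?linear_neq0. Qed.

Lemma mup_prod_linear j : mup (z j) f = e j.
Proof.
rewrite /f (bigD1 j) //= mupM ?expf_neq0 ?linear_neq0 //; last first.
  by apply/prodf_neq0 => i _; rewrite expf_neq0 ?linear_neq0.
rewrite mup_exp ?linear_neq0 // mup_linear eqxx muln1.
rewrite mupNroot ?addn0 // rootE horner_prod.
apply/prodf_neq0 => i ij; rewrite !hornerE expf_neq0 // subr_eq0.
by apply: contra_neq ij => /z_inj.
Qed.

Lemma size_prod_linear : (size f).-1 = (\sum_j e j)%N.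
Proof.
rewrite size_prod => [|j _]; last by rewrite expf_neq0 ?linear_neq0.
have sE j : size (((z j)%:P - 'X) ^+ e j) = (e j).+1.
  rewrite -[LHS]prednK ?size_poly_gt0 ?expf_neq0 ?linear_neq0 // size_exp.
  by rewrite -[_ - _]opprB size_polyN size_XsubC mul1n.
under eq_bigr do rewrite sE -addn1.
by rewrite big_split /= sum_nat_const card_ord muln1 -addSn addnK.
Qed.

(** Multiplicities at z_j give d | D e_j for every j. Cancelling gcd(d, D) leaves a divisor of d
    that divides every e_j, hence 1. *)
Lemma prod_linear_not_power d D (a b : {poly K}) (u : K) :
  (forall t, t %| d -> (forall j, t %| e j) -> t = 1)%N -> (0 < d)%N ->
  a != 0 -> b != 0 -> u != 0 -> a ^+ d * f ^+ D = u *: b ^+ d -> (d %| D)%N.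
Proof.
move=> de d0 a0 b0 u0 ab.
have dDe j : (d %| D * e j)%N.
  have := congr1 (mup (z j)) ab; rewrite -mul_polyC.
  rewrite mupM ?expf_neq0 ?prod_linear_neq0 // mup_exp // mup_exp ?prod_linear_neq0 //.
  rewrite mupMr ?rootC // mup_exp // mup_prod_linear => E.
  by rewrite -(dvdn_addr _ (dvdn_mulr (mup (z j) a) (dvdnn d))) E dvdn_mulr.
have g0 : (0 < gcdn d D)%N by rewrite gcdn_gt0 d0.
have [d' dE] := dvdnP (dvdn_gcdl d D).
have [D' DE] := dvdnP (dvdn_gcdr d D).
suff d'1 : d' = 1%N by rewrite dE d'1 mul1n dvdn_gcdr.
have cop : coprime d' D' by rewrite /coprime -(eqn_pmul2r g0) muln_gcdl -dE -DE mul1n.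
apply: de => [|j]; first by rewrite dE dvdn_mulr.
rewrite -(Gauss_dvdr _ cop) -(dvdn_pmul2r g0) -dE mulnAC -DE.
exact: dDe.
Qed.

End LinearFactors.

(** * Frobenius conjugates and their multiplicities *)

Definition power_Frobenius (R : comNzRingType) (q : nat) of [pchar R].-nat q :=
  fun x : R => x ^+ q.

Section PowerFrobenius.
Variables (R : comNzRingType) (q : nat) (pcharq : [pchar R].-nat q).

Fact power_Frobenius_is_zmod_morphism : zmod_morphism (power_Frobenius pcharq).
Proof. by move=> x y; rewrite /power_Frobenius exprDn_pchar // exprNn_pchar. Qed.

Fact power_Frobenius_is_monoid_morphism : monoid_morphism (power_Frobenius pcharq).
Proof. by split=> [|x y]; rewrite /power_Frobenius ?expr1n ?exprMn. Qed.

HB.instance Definition _ := GRing.isZmodMorphism.Build R R (power_Frobenius pcharq)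
  power_Frobenius_is_zmod_morphism.
HB.instance Definition _ := GRing.isMonoidMorphism.Build R R (power_Frobenius pcharq)
  power_Frobenius_is_monoid_morphism.

End PowerFrobenius.

Section ConjugateProduct.
Variables (K : fieldType) (q : nat).
Hypothesis pcharq : [pchar K].-nat q.
Let phi : {rmorphism K -> K} := power_Frobenius pcharq.

(** For x in F_{q^i}, the characteristic polynomial of x over F_q, a power of its minimal
    polynomial. *)
Definition conj_prod (i : nat) (x : K) : {poly K} :=
  \prod_(s < i) ('X - (x ^+ (q ^ s))%:P).

Lemma conj_prod_monic i x : conj_prod i x \is monic.
Proof. by apply: monic_prod => s _; exact: monicXsubC. Qed.

Lemma size_conj_prod i x : size (conj_prod i x) = i.+1.
Proof.
rewrite /conj_prod -(big_map (fun s : 'I_i => x ^+ (q ^ s)) predT (fun y => 'X - y%:P)).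
by rewrite size_prod_XsubC size_map /index_enum -enumT size_enum_ord.
Qed.

Lemma conj_prod_frob i x : x ^+ (q ^ i) = x ->
  map_poly phi (conj_prod i x) = conj_prod i x.
Proof.
case: i => [_|i xi]; first by rewrite /conj_prod !big_ord0 rmorph1.
rewrite /conj_prod rmorph_prod big_ord_recr [RHS]big_ord_recl /= mulrC.
have phiX (y : K) : map_poly phi ('X - y%:P) = 'X - (y ^+ q)%:P.
  by rewrite rmorphB /= map_polyX map_polyC.
congr (_ * _); first by rewrite phiX -exprM -expnSr xi expn0 expr1.
by apply: eq_bigr => s _; rewrite phiX -exprM -expnSr.
Qed.

Lemma frob_iter_inj s : injective (fun x : K => x ^+ (q ^ s)).
Proof.
have pn : [pchar K].-nat (q ^ s)%N by rewrite pnatX pcharq.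
move=> x y /eqP; rewrite -subr_eq0 -exprNn_pchar // -exprDn_pchar // expf_eq0.
by case/andP => _; rewrite subr_eq0 => /eqP.
Qed.

Section Count.
Variables (g : {poly K}) (rs : seq K).
Hypotheses (gE : g = \prod_(r <- rs) ('X - r%:P)) (g_frob : map_poly phi g = g).

Let g_neq0 : g != 0.
Proof. by rewrite gE monic_neq0 ?monic_prod_XsubC. Qed.

Let countE x r : (r <= count_mem x rs)%N = (('X - x%:P) ^+ r %| g).
Proof. by rewrite -mu_prod_XsubC -gE mup_geq. Qed.

Let count_frob x s : (count_mem x rs <= count_mem (x ^+ (q ^ s)) rs)%N.
Proof.
elim: s => [|s IH]; first by rewrite expn0 expr1.
apply: leq_trans IH _; rewrite countE -g_frob expnSr exprM.
have -> : 'X - ((x ^+ (q ^ s)) ^+ q)%:P = map_poly phi ('X - (x ^+ (q ^ s))%:P).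
  by rewrite rmorphB /= map_polyX map_polyC.
by rewrite -rmorphXn dvdp_map -countE.
Qed.

Let period_exists x : x \in rs ->
  exists i, (0 < i <= size rs)%N && (x ^+ (q ^ i) == x).
Proof.
(* The orbit of x consists of roots of [g]; by pigeonhole two iterates agree, and injectivity of
   Frobenius brings the coincidence back to x. *)
move=> xrs; pose t := [seq x ^+ (q ^ s) | s <- iota 0 (size rs).+1].
have trs : {subset t <= rs}.
  move=> _ /mapP[s _ ->]; rewrite -has_pred1 has_count.
  by apply: leq_trans (count_frob x s); rewrite -has_count has_pred1.
have : ~~ uniq t.
  by apply/negP => ut; have := uniq_leq_size ut trs; rewrite size_map size_iota ltnn.
case/(uniqPn 0) => a [b [ab]]; rewrite size_map size_iota => bs.
rewrite !(nth_map 0%N) ?size_iota ?(ltn_trans ab) // !nth_iota ?(ltn_trans ab) // !add0n.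
move=> eab; exists (b - a)%N; rewrite subn_gt0 ab leq_subLR /=.
rewrite (leq_trans _ (leq_addl _ _)) //=; apply/eqP/(@frob_iter_inj a).
by rewrite /= -exprM -expnD subnK ?(ltnW ab).
Qed.

(** For a root x, let d be its Frobenius period, P = [conj_prod d x] and r its multiplicity. Only i
    = k d counts; the product is then P^k, which divides [g] exactly when k <= r, since the d
    conjugates are distinct and at least as multiple as x. *)
Lemma count_conj_prod x :
  (\sum_(1 <= i < (size rs).+1)
     ((x ^+ (q ^ i) == x) && (conj_prod i x %| g))%R = count_mem x rs)%N.
Proof.
have dvd1 i : (0 < i)%N -> 'X - x%:P %| conj_prod i x.
  case: i => // i _; rewrite /conj_prod big_ord_recl expn0 expr1.
  exact: dvdp_mulIl.
have [xrs|xrs] := boolP (x \in rs); last first.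
  rewrite (count_memPn xrs) big_nat big1 // => i /andP[i0 _].
  case: (_ =P x) => //= _; case: (boolP (_ %| g)) => // /(dvdp_trans (dvd1 _ i0)).
  by rewrite -[_ - _]expr1 -countE (count_memPn xrs).
have [] := ex_minnP (period_exists xrs) => d /andP[/andP[d0 dn] /eqP xd] d_min.
have xdk k : x ^+ (q ^ (k * d)) = x.
  by elim: k => [|k IH]; rewrite ?expn0 ?expr1 // mulSn expnD exprM xd.
have xmod i : x ^+ (q ^ i) = x ^+ (q ^ (i %% d)).
  by rewrite {1}(divn_eq i d) expnD exprM xdk.
have xi i : (x ^+ (q ^ i) == x) = (d %| i)%N.
  rewrite xmod /dvdn; case: posnP => [->|id]; first by rewrite expn0 expr1 eqxx.
  apply/negbTE/negP => xid; have := d_min (i %% d)%N.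
  rewrite id xid (leq_trans (ltnW (ltn_pmod _ d0))) //= => /(_ isT).
  by rewrite leqNgt ltn_pmod.
pose P := conj_prod d x.
have PE r : conj_prod (r * d) x = P ^+ r.
  elim: r => [|r IH]; first by rewrite /conj_prod big_ord0.
  rewrite exprS -IH /conj_prod mulSn big_split_ord /=; congr (_ * _).
  by apply: eq_bigr => s _; rewrite expnD exprM xd.
set r := count_mem x rs.
have Pr : P ^+ r %| g.
  rewrite /P /conj_prod -prodrXl.
  suff H j : (j <= d)%N -> \prod_(s < j) ('X - (x ^+ (q ^ s))%:P) ^+ r %| g by exact: H.
  elim: j => [|j IH] jd; first by rewrite big_ord0 dvd1p.
  rewrite big_ord_recr /= Gauss_dvdp; first by rewrite IH ?(ltnW jd) //= -countE count_frob.
  apply: coprimep_expr; rewrite coprimep_XsubC; apply/rootP.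
  apply/eqP; rewrite horner_prod; apply/prodf_neq0 => s _.
  rewrite horner_exp !hornerE expf_neq0 // subr_eq0.
  apply/eqP => xjs; have sj := ltn_ord s.
  have : (x ^+ (q ^ (j - s)) == x).
    by apply/eqP/(@frob_iter_inj s); rewrite /= -exprM -expnD subnK ?(ltnW sj).
  rewrite xi => /dvdn_leq; rewrite subn_gt0 sj => /(_ isT).
  by rewrite leqNgt (leq_ltn_trans (leq_subr _ _) jd).
have rn : (r * d <= size rs)%N.
  by have := dvdp_leq g_neq0 Pr; rewrite -PE size_conj_prod gE size_prod_XsubC ltnS.
transitivity (\sum_(1 <= i < (size rs).+1) ((d %| i) && (i <= r * d)))%N.
  apply: eq_big_nat => i /andP[i0 _]; rewrite xi; congr nat_of_bool.
  case: (boolP (d %| i)%N) => //= /dvdnP[k ik].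
  rewrite ik leq_pmul2r // PE; apply/idP/idP => [Pk|kr]; last first.
    by apply: dvdp_trans Pr; rewrite dvdp_exp2l.
  rewrite countE; apply: dvdp_trans Pk; apply: dvdp_exp2r; exact: dvd1.
rewrite (@big_cat_nat _ _ _ (r * d).+1) ?ltnS //= [X in (_ + X)%N]big_nat.
rewrite [X in (_ + X)%N]big1 ?addn0; last first.
  by move=> i /andP[]; rewrite ltnNge => /negPf ->; rewrite andbF.
rewrite -[RHS](mulnK r d0) divn_count_dvd; apply: eq_big_nat => i /andP[_].
by rewrite ltnS => ->; rewrite andbT.
Qed.

End Count.
End ConjugateProduct.

(** * Newton's identities for the L-function *)

(** Indexing by the row of lower coefficients makes the monic polynomials of degree n a finite type
    to sum over. *)
Definition monic_of_row (R : nzRingType) n (a : 'rV[R]_n) : {poly R} := 'X^n + rVpoly a.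

Section MonicOfRow.
Variables (R : nzRingType) (n : nat).
Implicit Type a : 'rV[R]_n.

Lemma size_monic_of_row a : size (monic_of_row a) = n.+1.
Proof. by rewrite size_polyDl size_polyXn // ltnS size_poly. Qed.

Lemma monic_of_row_monic a : monic_of_row a \is monic.
Proof.
by rewrite monicE lead_coefDl ?lead_coefXn // size_polyXn ltnS size_poly.
Qed.

Lemma monic_of_rowK : cancel (@monic_of_row R n) (fun p => poly_rV (p - 'X^n)).
Proof. by move=> a; rewrite /monic_of_row addrC addKr rVpolyK. Qed.

Lemma poly_rV_monicK (p : {poly R}) : p \is monic -> size p = n.+1 ->
  monic_of_row (poly_rV (p - 'X^n) : 'rV_n) = p.
Proof.
move=> pm sp; rewrite /monic_of_row poly_rV_K; first by rewrite addrC subrK.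
apply/leq_sizeP => j nj; rewrite coefB coefXn.
move: nj; rewrite leq_eqVlt => /orP[/eqP<-|nj].
  by rewrite eqxx -[p`_n]/(p`_n.+1.-1) -sp -lead_coefE (monicP pm) subrr.
by rewrite gtn_eqF // subr0 nth_default // sp.
Qed.
End MonicOfRow.

Section LFunction.
Variables (F : finFieldType) (K : closedFieldType) (iota : {rmorphism F -> K}).
Local Notation q := #|F|.

Lemma pnat_pchar_card : [pchar K].-nat q.
Proof.
have [p p_pr pF] := finPcharP F.
have pK : p \in [pchar K] by rewrite (fmorph_pchar iota).
rewrite (eq_pnat _ (pcharf_eq pK)).
have := pprimeChar_pgroup pF.
by rewrite /pgroup cardsT.
Qed.

Lemma card_field_gt1 : (1 < q)%N. Proof. exact: finNzRing_gt1. Qed.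

(** Inverse of [iota] on its image. The default 0 is harmless for elements fixed by the q-th power,
    which [descendK] places in the image. *)
Definition descend (y : K) : F := odflt 0 [pick a | iota a == y].

Lemma descendK y : y ^+ q = y -> iota (descend y) = y.
Proof.
move=> yq; rewrite /descend; case: pickP => [a /eqP//|no].
have : root (map_poly iota ('X^q - 'X)) y.
  by rewrite rmorphB /= map_polyXn map_polyX rootE !hornerE yq subrr.
rewrite finField_genPoly rmorph_prod /= rootE horner_prod => /prodf_eq0[a _].
by rewrite rmorphB /= map_polyX map_polyC !hornerE subr_eq0 eq_sym no.
Qed.

Lemma descendE a : descend (iota a) = a.
Proof. by apply: (fmorph_inj iota); rewrite descendK // -rmorphXn expf_card. Qed.

(** For x in F_{q^i}, a polynomial over F whose value at y in F is the norm of y - x. *)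
Definition norm_poly (i : nat) (x : K) : {poly F} :=
  map_poly descend (conj_prod q i x).

Lemma map_norm_poly i x : x ^+ (q ^ i) = x ->
  map_poly iota (norm_poly i x) = conj_prod q i x.
Proof.
move=> xi; apply/polyP => j; rewrite coef_map coef_map_id0; last first.
  by rewrite -(rmorph0 iota) descendE.
apply: descendK.
by rewrite -[in RHS](conj_prod_frob pnat_pchar_card xi) coef_map.
Qed.

Lemma norm_poly_monic i x : x ^+ (q ^ i) = x -> norm_poly i x \is monic.
Proof. by move=> xi; rewrite -(map_monic iota) map_norm_poly // conj_prod_monic. Qed.

Lemma size_norm_poly i x : x ^+ (q ^ i) = x -> size (norm_poly i x) = i.+1.
Proof. by move=> xi; rewrite -(size_map_poly iota) map_norm_poly // size_conj_prod. Qed.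

(** After exchanging the sums, each distinct root counts with its multiplicity. This is the
    polynomial analogue of log n as a sum of von Mangoldt values over the divisors of n. *)
Lemma count_norm_poly_dvd n (g : {poly F}) : g \is monic -> size g = n.+1 ->
  (\sum_(1 <= i < n.+1) count (fun x => (norm_poly i x %| g)%R) (fixed_points K (q ^ i)))%N = n.
Proof.
move=> gm sg; pose gK := map_poly iota g.
have gKm : gK \is monic by rewrite map_monic.
have [rs gE] := closed_field_poly_normal gK.
rewrite (monicP gKm) scale1r in gE.
have srs : size rs = n.
  by apply: succn_inj; rewrite -sg -(size_map_poly iota) -/gK gE size_prod_XsubC.
have gfrob : map_poly (power_Frobenius pnat_pchar_card) gK = gK.
  apply/polyP => j; rewrite coef_map /gK coef_map /= /power_Frobenius.
  by rewrite -rmorphXn /= expf_card.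
transitivity (\sum_(x <- undup rs) count_mem x rs)%N; last first.
  rewrite -srs -[RHS](perm_size (perm_count_undup rs)) size_flatten /shape.
  by rewrite -map_comp sumnE big_map; apply: eq_bigr => x _; rewrite /= size_nseq.
under [RHS]eq_bigr => x _ do
  rewrite -(count_conj_prod gE gfrob x).
rewrite srs exchange_big /=; apply: eq_big_nat => i /andP[i0 _].
have qi1 : (1 < q ^ i)%N by rewrite -(expn0 q) ltn_exp2l // card_field_gt1.
have pcqi : [pchar K].-nat (q ^ i)%N by rewrite pnatX pnat_pchar_card.
pose B x := (x ^+ (q ^ i) == x) && (conj_prod q i x %| gK).
transitivity (count B (undup rs)); last first.
  by rewrite -sum1_count big_mkcond; apply: eq_bigr => x _; rewrite -/(B x); case: (B x).
rewrite -!size_filter; apply: perm_size; apply: uniq_perm.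
- exact: filter_uniq (fixed_points_uniq _ _).
- exact: filter_uniq (undup_uniq _).
move=> x; rewrite !mem_filter mem_undup (mem_fixed_points qi1) /B.
rewrite [LHS]andbC -andbA; have [xi|//] := eqP; rewrite /=.
rewrite -(map_norm_poly xi) dvdp_map; have [ng|//] := boolP (_ %| g).
symmetry; rewrite /= -root_prod_XsubC -gE -dvdp_XsubCl.
move: ng; rewrite -(dvdp_map iota) -/gK map_norm_poly //; apply: dvdp_trans.
rewrite /conj_prod; case: (i) i0 => // i' _; rewrite big_ord_recl expn0 expr1.
exact: dvdp_mulIl.
Qed.

Section Newton.
Variables (C : comNzRingType) (G : {poly F} -> C).
Hypothesis GM : forall g h, G (g * h) = G g * G h.

(** Coefficient of T^n in the L-series of [G]; [Lsum i], the sum over the extension of degree i, is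
    the i-th coefficient of T L'/L. *)
Definition Lcoef n : C := \sum_(a : 'rV[F]_n) G (monic_of_row a).
Definition Lsum i : C := \sum_(x <- fixed_points K (q ^ i)) G (norm_poly i x).

Lemma sum_monic_multiples n i (p : {poly F}) : p \is monic -> size p = i.+1 -> (i <= n)%N ->
  \sum_(a : 'rV[F]_n | p %| monic_of_row a) G (monic_of_row a) = G p * Lcoef (n - i).
Proof.
move=> pm sp lin; rewrite /Lcoef mulr_sumr.
have p0 := monic_neq0 pm.
have prodE (b : 'rV[F]_(n - i)) :
    monic_of_row (poly_rV (p * monic_of_row b - 'X^n) : 'rV_n) = p * monic_of_row b.
  apply: poly_rV_monicK; first by rewrite monicMl // monic_of_row_monic.
  rewrite size_monicM ?monic_neq0 ?monic_of_row_monic // size_monic_of_row sp.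
  by rewrite addSn addnS /= subnKC.
rewrite (reindex_onto (fun b : 'rV_(n - i) => poly_rV (p * monic_of_row b - 'X^n))
   (fun a => poly_rV (monic_of_row a %/ p - 'X^(n - i)))) /= => [|a pa].
  apply: eq_big => [b|b _]; last by rewrite prodE GM.
  by rewrite prodE dvdp_mulIl mulKp // monic_of_rowK eqxx.
rewrite poly_rV_monicK.
- by rewrite mulrC divpK // monic_of_rowK.
- by rewrite -(monicMl _ pm) mulrC divpK // monic_of_row_monic.
- by rewrite size_divp // size_monic_of_row sp subSn.
Qed.

(** The weight n of each monic polynomial is replaced by the number of pairs (i, x) for which
    [norm_poly i x] divides it. The multiples of one such divisor contribute its value under [G]
    times [Lcoef (n - i)]. *)
Theorem Newton_Lcoef n :
  Lcoef n *+ n = \sum_(1 <= i < n.+1) Lsum i * Lcoef (n - i).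
Proof.
rewrite /Lcoef -sumrMnl.
transitivity (\sum_(a : 'rV[F]_n) \sum_(1 <= i < n.+1)
   \sum_(x <- fixed_points K (q ^ i) | norm_poly i x %| monic_of_row a) G (monic_of_row a)).
  apply: eq_bigr => a _.
  rewrite -[in X in _ *+ X](count_norm_poly_dvd (monic_of_row_monic a) (size_monic_of_row a)).
  rewrite -mulr_natr natr_sum mulr_sumr; apply: eq_bigr => i _.
  by rewrite mulr_natr big_const_seq iter_addr_0.
rewrite exchange_big /=; apply: eq_big_nat => i /andP[i0 lin].
rewrite mulr_suml [RHS]big_seq.
under eq_bigr => a _ do rewrite big_mkcond big_seq.
rewrite exchange_big /=; apply: eq_bigr => x xi.
have qi1 : (1 < q ^ i)%N by rewrite -(expn0 q) ltn_exp2l // card_field_gt1.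
move: xi; rewrite (mem_fixed_points qi1) => /eqP xi.
by rewrite -big_mkcond (@sum_monic_multiples n i) ?norm_poly_monic ?size_norm_poly.
Qed.

End Newton.
End LFunction.

(** * Vanishing of the L-coefficients in high degree *)

Section CharacterSumVanishing.
Variables (F : finFieldType) (C : idomainType) (m : nat).
Variables (z : 'I_m -> F) (chi : 'I_m -> F -> C).
Hypotheses (z_inj : injective z) (chiM : forall j x y, chi j (x * y) = chi j x * chi j y).

Definition char_prod (g : {poly F}) : C := \prod_j chi j g.[z j].

Lemma char_prodM g h : char_prod (g * h) = char_prod g * char_prod h.
Proof. by rewrite -big_split /=; apply: eq_bigr => j _; rewrite hornerM chiM. Qed.

(* Changing the value at one node by a factor [u], and no other node value, is a
   bijection of the monic polynomials of degree n. *)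
Lemma Lcoef_char_prod_eq0 n j0 u : (m <= n)%N -> u != 0 -> chi j0 u != 1 ->
  Lcoef char_prod n = 0.
Proof.
move=> mn u0 chiu.
pose l0 := \prod_(j | j != j0) ('X - (z j)%:P).
have l0z : l0.[z j0] != 0.
  rewrite horner_prod; apply/prodf_neq0 => j jj0; rewrite !hornerE subr_eq0.
  by apply: contra_neq jj0 => /z_inj.
(* Lagrange basis polynomial of the node z_j0. Its degree m - 1 is below n, so adding a multiple of
   it keeps a polynomial monic of degree n. *)
pose l := l0.[z j0]^-1 *: l0.
have lz j : l.[z j] = (j == j0)%:R.
  rewrite hornerZ; have [->|jj0] := eqVneq; first by rewrite mulVf.
  by rewrite [l0.[z j]]horner_prod (bigD1 j) //= hornerXsubC subrr mul0r mulr0.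
have sl : (size l <= n)%N.
  rewrite size_scale ?invr_eq0 // /l0.
  rewrite -big_filter -(big_map z predT (fun y => 'X - y%:P)) size_prod_XsubC size_map.
  rewrite size_filter; apply: leq_trans mn.
  have := count_predC (pred1 j0) (index_enum 'I_m).
  rewrite (count_uniq_mem _ (index_enum_uniq _)) mem_index_enum add1n => ->.
  by rewrite /index_enum -enumT size_enum_ord.
pose T v (a : 'rV[F]_n) : 'rV[F]_n :=
  a + poly_rV (((v - 1) * (monic_of_row a).[z j0]) *: l).
have monicT v a : monic_of_row (T v a) =
    monic_of_row a + ((v - 1) * (monic_of_row a).[z j0]) *: l.
  rewrite /monic_of_row /T linearD /= poly_rV_K ?addrA //.
  exact: leq_trans (size_scale_leq _ _) sl.
have TT v w : v * w = 1 -> cancel (T w) (T v).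
  move=> vw a; rewrite {1}/T monicT hornerD hornerZ lz eqxx mulr1 /T -addrA -linearD /=.
  rewrite -scalerDl [X in X *: l](_ : _ = (v * w - 1) * (monic_of_row a).[z j0]); last by ring.
  by rewrite vw subrr mul0r scale0r linear0 addr0.
have Tbij : bijective (T u) by exists (T u^-1); apply: TT; rewrite ?mulVf ?mulfV.
have GT a : char_prod (monic_of_row (T u a)) = chi j0 u * char_prod (monic_of_row a).
  rewrite /char_prod (bigD1 j0) //= [in RHS](bigD1 j0) //= mulrA -chiM monicT.
  rewrite hornerD hornerZ lz eqxx mulr1; congr (chi _ _ * _); first by ring.
  by apply: eq_bigr => j /negPf jj0; rewrite hornerD hornerZ lz jj0 mulr0 addr0.
have : Lcoef char_prod n = chi j0 u * Lcoef char_prod n.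
  rewrite [LHS](reindex (T u)) /=; last exact: onW_bij.
  by rewrite mulr_sumr; apply: eq_bigr => a _; rewrite GT.
move/eqP; rewrite -[X in X == _]mul1r -subr_eq0 -mulrBl mulf_eq0 subr_eq0 eq_sym.
by rewrite (negPf chiu) => /eqP.
Qed.

End CharacterSumVanishing.

(** * Reciprocal roots and their power sums *)

Definition reciprocal_prod (R : comNzRingType) (ws : seq R) : {poly R} :=
  \prod_(w <- ws) (1 - w *: 'X).

(** Induction on [ws]: on passing from L to (1 - w X) L, the terms w^i times a coefficient telescope
    to w L_n. The sign is why [Lsum] will be minus a power sum. *)
Lemma Newton_power_sums (R : comNzRingType) (ws : seq R) n :
  (reciprocal_prod ws)`_n *+ n =
    - \sum_(1 <= i < n.+1) (\sum_(w <- ws) w ^+ i) * (reciprocal_prod ws)`_(n - i).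
Proof.
elim: ws n => [|w ws IH] n.
  rewrite /reciprocal_prod big_nil coef1; under eq_bigr do rewrite big_nil mul0r.
  by rewrite big1 // oppr0; case: n => [|n]; rewrite ?mulr0n ?mul0rn.
pose L := reciprocal_prod ws.
have LE k : (reciprocal_prod (w :: ws))`_k = L`_k - w * (if k is k'.+1 then L`_k' else 0).
  rewrite /reciprocal_prod big_cons -/(reciprocal_prod ws) -/L mulrBl mul1r coefB.
  by rewrite -scalerAl coefZ coefXM; case: k.
case: n => [|n]; first by rewrite mulr0n big_geq ?oppr0.
have split_i i : \sum_(v <- w :: ws) v ^+ i = w ^+ i + \sum_(v <- ws) v ^+ i.
  by rewrite big_cons.
under eq_bigr => i _ do rewrite split_i mulrDl.
rewrite big_split /=.
have -> : \sum_(1 <= i < n.+2) w ^+ i * (reciprocal_prod (w :: ws))`_(n.+1 - i) = w * L`_n.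
  pose f k := - (w ^+ k * (if (k <= n.+1)%N then L`_(n.+1 - k) else 0)).
  rewrite (eq_big_nat _ _ (F2 := fun i => f i.+1 - f i)) => [|i /andP[i0]].
    rewrite telescope_sumr // /f ltnn /= mulr0 oppr0 sub0r opprK expr1.
    by rewrite subSS subn0.
  rewrite ltnS => lin; rewrite LE /f lin opprK mulrBr exprSr addrC; congr (_ + _).
  case: ltnP => [lin'|nli]; first by rewrite subSn // subSS mulrA.
  by rewrite (eqP (_ : n.+1 - i == 0)%N) ?mulr0.
have -> : \sum_(1 <= i < n.+2) (\sum_(v <- ws) v ^+ i) * (reciprocal_prod (w :: ws))`_(n.+1 - i)
   = - (L`_n.+1 *+ n.+1) + w * (L`_n *+ n).
  under eq_bigr => i _ do rewrite LE mulrBr.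
  rewrite sumrB IH opprK; congr (_ + _).
  rewrite big_nat_recr //= subnn mulr0 mulr0 addr0 IH mulrN mulr_sumr.
  congr (- _).
  apply: eq_big_nat => i /andP[i0]; rewrite ltnS => lin.
  by rewrite subSn //= mulrCA.
rewrite LE mulrnBl mulrnAr mulrSr; ring.
Qed.

Lemma reciprocal_prodP (C : closedFieldType) (p : {poly C}) : p`_0 = 1 ->
  exists2 ws : seq C, p = reciprocal_prod ws & size ws = (size p).-1.
Proof.
move=> p01; have [rs pE] := closed_field_poly_normal p.
have p0 : p != 0 by apply: contra_eq_neq p01 => ->; rewrite coef0 eq_sym oner_eq0.
have lp : lead_coef p != 0 by rewrite lead_coef_eq0.
have rs0 r : r \in rs -> r != 0.
  move=> rrs; apply: contra_eq_neq p01 => r0.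
  rewrite -horner_coef0 pE hornerZ [X in _ * X](_ : _ = 0) ?mulr0 1?eq_sym ?oner_eq0 //.
  by apply/eqP; rewrite -[_ == 0]/(root _ 0) root_prod_XsubC -r0.
exists [seq r^-1 | r <- rs]; last first.
  by rewrite size_map {1}pE size_scale // size_prod_XsubC.
have : lead_coef p * \prod_(r <- rs) (- r) = 1.
  apply: etrans p01; rewrite -[in RHS]horner_coef0 [in RHS]pE hornerZ horner_prod.
  by congr (_ * _); apply: eq_bigr => r _; rewrite hornerXsubC sub0r.
rewrite /reciprocal_prod big_map => lE.
have rsE : \prod_(r <- rs) ('X - r%:P) =
    (\prod_(r <- rs) (- r)) *: \prod_(r <- rs) (1 - r^-1 *: 'X).
  rewrite -mul_polyC rmorph_prod -big_split /= big_seq [RHS]big_seq.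
  apply: eq_bigr => r rr; rewrite mul_polyC scalerBr scalerA mulNr mulfV ?rs0 //.
  by rewrite scaleN1r opprK addrC -polyCN -[(- r)%:P]mulr1 mul_polyC.
by rewrite [LHS]pE rsE scalerA lE scale1r.
Qed.

Section PowerSumBound.
Variable C : numClosedFieldType.

Lemma exists_max_norm (ws : seq C) w : w \in ws ->
  exists2 a, a \in ws & forall v, v \in ws -> `|v| <= `|a|.
Proof.
elim: ws w => // w0 ws IH w _.
case: ws IH => [|v ws] IH.
  by exists w0; rewrite ?mem_head // => v; rewrite inE => /eqP->.
have [a aws amax] := IH v (mem_head _ _).
have /orP[le|le] : (`|w0| <= `|a|) || (`|a| <= `|w0|).
  by have := real_leVge (normr_real w0) (normr_real a).
- exists a; first by rewrite inE aws orbT.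
  by move=> u; rewrite inE => /orP[/eqP->//|/amax].
- exists w0; first exact: mem_head.
  move=> u; rewrite inE => /orP[/eqP->//|/amax ua]; exact: le_trans ua le.
Qed.

(** Uniform in N, also on the unit circle away from 1; this separates reciprocal roots of equal
    modulus. *)
Lemma geometric_bound (x : C) N : `|x| <= 1 -> x != 1 ->
  `|\sum_(k < N) x ^+ k| <= 2 / `|1 - x|.
Proof.
move=> x1 xn1; rewrite ler_pdivlMr ?normr_gt0 ?subr_eq0 1?eq_sym // -normrM.
rewrite mulrC -[1 - x]opprB mulNr -subrX1 opprB.
apply: le_trans (ler_normB _ _) _; rewrite normr1 normrX (natrD _ 1 1) lerD2l.
by rewrite exprn_ile1.
Qed.

Hypothesis archiC : forall x : C, 0 <= x -> exists n : nat, x < n%:R.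

(* Average [p_k / a ^ k] over k, where [a] has maximal modulus: the other ratios
   contribute bounded geometric sums, while [a] itself contributes 1. *)
Lemma power_sum_bound (ws : seq C) (A B : C) : 0 <= A -> 0 < B ->
  (forall k, `|\sum_(w <- ws) w ^+ k| <= A * B ^+ k) ->
  forall w, w \in ws -> `|w| <= B.
Proof.
move=> A0 B0 bound w0 w0ws; have [a aws amax] := exists_max_norm w0ws.
apply: le_trans (amax _ w0ws) _; rewrite real_leNgt ?normr_real ?gtr0_real //.
apply/negP => Ba; have na0 : 0 < `|a| := lt_trans B0 Ba.
have a0 : a != 0 by rewrite -normr_gt0.
(* [D] bounds, independently of N, the ratios w/a with w != a and the summed hypothesis. What
   remains is N times the multiplicity of [a], so N <= D for every N, against [archiC]. *)
pose D := \sum_(w <- ws | w != a) 2 / `|1 - w / a| + A * (2 / `|1 - B / `|a| |).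
have D0 : 0 <= D.
  apply: addr_ge0; last by rewrite mulr_ge0 // divr_ge0.
  by apply: sumr_ge0 => w _; rewrite divr_ge0.
have [N DN] := archiC D0.
suff : N%:R <= D by move=> /le_lt_trans-/(_ _ DN); rewrite ltxx.
have ws_split : \sum_(k < N) (\sum_(w <- ws) w ^+ k) / a ^+ k =
    (N * count_mem a ws)%:R + \sum_(w <- ws | w != a) \sum_(k < N) (w / a) ^+ k.
  under eq_bigr => k _ do rewrite mulr_suml.
  rewrite exchange_big /= (bigID (pred1 a)) /=; congr (_ + _).
    rewrite (eq_bigr (fun=> N%:R)) => [|w /eqP->]; last first.
      under eq_bigr do rewrite mulfV ?expf_neq0 //.
      by rewrite sumr_const card_ord.
    by rewrite big_const_seq iter_addr_0 natrM mulr_natr.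
  by apply: eq_bigr => w _; apply: eq_bigr => k _; rewrite expr_div_n.
have c0 : (0 < count_mem a ws)%N by rewrite -has_count has_pred1.
have -> : N%:R = `|N%:R| :> C by rewrite normr_nat.
apply: (@le_trans _ _ `|(N * count_mem a ws)%:R : C|).
  by rewrite !normr_nat ler_nat leq_pmulr.
rewrite -[X in `|X|](addrK (\sum_(w <- ws | w != a) \sum_(k < N) (w / a) ^+ k)) -ws_split.
rewrite addrC; apply: le_trans (ler_normD _ _) _; rewrite normrN; apply: lerD.
  apply: le_trans (ler_norm_sum _ _ _) _; rewrite big_seq_cond [X in _ <= X]big_seq_cond.
  apply: ler_sum => w /andP[wws wa]; apply: geometric_bound.
    by rewrite normrM normfV ler_pdivrMr // mul1r amax.
  by apply: contra_neq wa => /(congr1 (fun x => x * a)); rewrite divfK // mul1r.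
apply: (@le_trans _ _ (A * \sum_(k < N) (B / `|a|) ^+ k)).
  rewrite mulr_sumr; apply: le_trans (ler_norm_sum _ _ _) _; apply: ler_sum => k _.
  rewrite normrM normfV normrX expr_div_n mulrA ler_wpM2r //.
  by rewrite invr_ge0 exprn_ge0.
have r0 : 0 <= B / `|a| by rewrite divr_ge0 // ltW.
have r1 : B / `|a| < 1 by rewrite ltr_pdivrMr // mul1r.
have S0 : 0 <= \sum_(k < N) (B / `|a|) ^+ k by apply: sumr_ge0 => k _; rewrite exprn_ge0.
rewrite ler_wpM2l // -(ger0_norm S0) geometric_bound ?lt_eqF //.
by rewrite ger0_norm // ltW.
Qed.

End PowerSumBound.

(** * Multiplicative characters and Weil's bound *)

(** Turns upper bounds into a bound for the modulus: as the [w s] sum to 0, d N_s may be replaced by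
    its defect M - d N_s >= 0, and the triangle inequality leaves the total defect, small once the
    N_s nearly add up to M. *)
Lemma balanced_sum_bound (C : numClosedFieldType) d (w : 'I_d -> C) (N : 'I_d -> nat) (M : nat) :
  (forall s, `|w s| = 1) -> \sum_s w s = 0 -> (forall s, d * N s <= M)%N ->
  d%:R * `|\sum_s w s * (N s)%:R| <= (d * M - d * \sum_s N s)%:R.
Proof.
move=> w1 w0 NM.
have -> : d%:R * `|\sum_s w s * (N s)%:R| = `|\sum_s w s * (M - d * N s)%:R|.
  rewrite -(normr_nat C d) -normrM -[RHS]normrN; congr `|_|.
  under [in RHS]eq_bigr => s _ do rewrite natrB // mulrBr.
  rewrite sumrB -mulr_suml w0 mul0r sub0r opprK mulr_sumr; apply: eq_bigr => s _.
  by rewrite natrM mulrCA.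
apply: le_trans (ler_norm_sum _ _ _) _.
rewrite (eq_bigr (fun s => (M - d * N s)%:R)) => [|s _]; last by rewrite normrM w1 mul1r normr_nat.
rewrite -natr_sum ler_nat sumnB //.
by rewrite sum_nat_const card_ord -big_distrr.
Qed.

Lemma exists_primitive_root (C : numClosedFieldType) n : (0 < n)%N ->
  exists z : C, n.-primitive_root z.
Proof.
move=> n_gt0; pose p : {poly C} := 'X^n - 1; have [r Dp] := closed_field_poly_normal p.
rewrite (monicP _) ?monicXnsubC // scale1r in Dp.
have rn1 : all n.-unity_root r by apply/allP=> z; rewrite -root_prod_XsubC -Dp.
have sz_r : (n < (size r).+1)%N by rewrite -(size_prod_XsubC r id) -Dp size_XnsubC.
have [|z] := hasP (has_prim_root n_gt0 rn1 _ sz_r); last by exists z.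
by rewrite -separable_prod_XsubC -Dp separable_Xn_sub_1 // pnatr_eq0 -lt0n.
Qed.

Lemma finField_primitive_root (F : finFieldType) :
  exists g : F, (#|F|.-1).-primitive_root g.
Proof.
have n0 : (0 < #|F|.-1)%N by rewrite -subn1 subn_gt0 finNzRing_gt1.
pose s := [seq x <- enum F | x != 0].
have su : uniq s by rewrite filter_uniq ?enum_uniq.
have sz : size s = #|F|.-1.
  rewrite -(cardC1 (0 : F)) -(card_uniqP su); apply: eq_card => x.
  by rewrite mem_filter mem_enum andbT.
have [||g _ gp] := hasP (@has_prim_root F #|F|.-1 s n0 _ su _); last by exists g.
- apply/allP => x; rewrite mem_filter => /andP[x0 _]; apply/unity_rootP.
  by apply: (mulfI x0); rewrite -exprS mulr1 prednK ?expf_card // ltnW // finNzRing_gt1.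
- by rewrite sz.
Qed.

Section MultiplicativeCharacter.
Variables (F : finFieldType) (C : numClosedFieldType) (g : F) (zeta : C).
Local Notation n := #|F|.-1.
Hypotheses (g_prim : n.-primitive_root g) (zeta_prim : n.-primitive_root zeta).

(** A generator of the group of multiplicative characters, extended by 0; every character is one of
    its powers. *)
Definition mult_char (x : F) : C :=
  if [pick i : 'I_n | g ^+ i == x] is Some i then zeta ^+ i else 0.

Let n_gt0 : (0 < n)%N := prim_order_gt0 g_prim.

Lemma primitive_root_neq0 : g != 0.
Proof.
apply/eqP => g0; have := prim_expr_order g_prim.
by rewrite g0 expr0n gtn_eqF // => /eqP; rewrite eq_sym oner_eq0.
Qed.

Lemma mult_char0 : mult_char 0 = 0.
Proof.
by rewrite /mult_char; case: pickP => // i; rewrite expf_eq0 (negPf primitive_root_neq0) andbF.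
Qed.

Lemma mult_char_exp i : mult_char (g ^+ i) = zeta ^+ i.
Proof.
rewrite /mult_char; case: pickP => [j /eqP/eqP|].
  by rewrite (eq_prim_root_expr g_prim) => ij; apply/eqP; rewrite (eq_prim_root_expr zeta_prim).
move/(_ (Ordinal (ltn_pmod i n_gt0))).
by rewrite /= (prim_expr_mod g_prim) eqxx.
Qed.

Lemma primitive_root_log x : x != 0 -> exists i, x = g ^+ i.
Proof.
move=> x0; have [|i ->] := prim_rootP g_prim (_ : x ^+ n = 1); last by exists i.
by apply: (mulfI x0); rewrite -exprS mulr1 prednK ?expf_card // ltnW // finNzRing_gt1.
Qed.

Lemma mult_charM x y : mult_char (x * y) = mult_char x * mult_char y.
Proof.
have [->|/primitive_root_log[i ->]] := eqVneq x 0; first by rewrite mul0r mult_char0 mul0r.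
have [->|/primitive_root_log[j ->]] := eqVneq y 0; first by rewrite mulr0 mult_char0 mulr0.
by rewrite -exprD !mult_char_exp exprD.
Qed.

Lemma mult_char1 : mult_char 1 = 1.
Proof. by rewrite -(expr0 g) mult_char_exp expr0. Qed.

Lemma mult_charX x k : mult_char (x ^+ k) = mult_char x ^+ k.
Proof. by elim: k => [|k IH]; rewrite ?mult_char1 // !exprS mult_charM IH. Qed.

Lemma norm_mult_char x : x != 0 -> `|mult_char x| = 1.
Proof.
move=> /primitive_root_log[i ->]; rewrite mult_char_exp normrX.
suff -> : `|zeta| = 1 by rewrite expr1n.
by apply/eqP; rewrite -(@pexpr_eq1 _ _ n) // -normrX (prim_expr_order zeta_prim) normr1.
Qed.

End MultiplicativeCharacter.

(** By Frobenius the difference is (f - f(0))^Q. For Q = d e + 1 this says that f^e solves f Y^d =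
    f(0)^Q modulo X^Q. *)
Lemma dvdp_Xn_exp_sub (K : fieldType) (f : {poly K}) Q :
  [pchar K].-nat Q -> 'X^Q %| f ^+ Q - (f.[0] ^+ Q)%:P.
Proof.
move=> pQ; have cQ : [pchar {poly K}].-nat Q by rewrite (eq_pnat _ (pchar_poly _)).
rewrite polyC_exp -exprNn_pchar // -exprDn_pchar //; apply: dvdp_exp2r.
by rewrite -['X]subr0 -[0 in X in X %| _]/(0%:P) dvdp_XsubCl rootE !hornerE subrr.
Qed.

Lemma horner_conj_prod (K : fieldType) (q i : nat) (x y : K) :
  [pchar K].-nat q -> y ^+ q = y ->
  (conj_prod q i x).[y] = (y - x) ^+ (\sum_(s < i) q ^ s).
Proof.
move=> pq yq; rewrite /conj_prod horner_prod -prodrXr.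
apply: eq_bigr => s _.
have ps : [pchar K].-nat (q ^ s)%N by rewrite pnatX pq.
rewrite hornerXsubC exprDn_pchar // exprNn_pchar //; congr (_ - _).
by elim: (nat_of_ord s) => [|k IH]; rewrite ?expn0 ?expr1 // expnS exprM yq.
Qed.

Section WeilBound.
Variables (F : finFieldType) (C : numClosedFieldType) (g : F) (zeta : C).
Local Notation q := #|F|.
Hypotheses (g_prim : (q.-1).-primitive_root g) (zeta_prim : (q.-1).-primitive_root zeta).
Hypothesis archiC : forall x : C, 0 <= x -> exists n : nat, x < n%:R.
Local Notation chi := (mult_char g zeta).
Variables (m : nat) (z : 'I_m -> F) (e : 'I_m -> nat).
Hypotheses (z_inj : injective z) (z_neq0 : forall j, z j != 0).
Variable j0 : 'I_m.
Hypothesis e_j0 : ~~ (q.-1 %| e j0)%N.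

Let G : {poly F} -> C := char_prod z (fun j x => chi x ^+ e j).

Let GM p r : G (p * r) = G p * G r.
Proof. by apply: char_prodM => j x y; rewrite mult_charM // exprMn. Qed.

Let q_gt1 : (1 < q)%N := card_field_gt1 F.
Let n_gt0 : (0 < q.-1)%N := prim_order_gt0 g_prim.

Section Extension.
Variables (K : closedFieldType) (iota : {rmorphism F -> K}).
Let pcharq : [pchar K].-nat q := pnat_pchar_card iota.

(* Dividing the exponents by [t] makes f^((Q-1)/d) equidistributed in the d-th
   roots of unity. *)
Let t := \big[gcdn/q.-1]_j e j.
Let d := (q.-1 %/ t)%N.
Let e' j := (e j %/ t)%N.
Let f : {poly K} := \prod_j ((iota (z j))%:P - 'X) ^+ e' j.

Let t_dvd_n : (t %| q.-1)%N.
Proof. by rewrite /t -big_id_idem ?dvdn_gcdr //; exact: gcdnn. Qed.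
Let t_dvd_e j : (t %| e j)%N.
Proof. by rewrite /t (bigD1 j) //= dvdn_gcdl. Qed.
Let t_max u : (u %| q.-1)%N -> (forall j, u %| e j)%N -> (u %| t)%N.
Proof.
move=> un ue; apply: (big_ind (fun v => u %| v)%N) => // v w uv uw.
by rewrite dvdn_gcd uv.
Qed.
Let t_gt0 : (0 < t)%N. Proof. exact: dvdn_gt0 t_dvd_n. Qed.
Let dt : (d * t = q.-1)%N. Proof. exact: divnK. Qed.
Let e't j : (e' j * t = e j)%N. Proof. exact: divnK. Qed.
Let d_gt1 : (1 < d)%N.
Proof.
rewrite ltn_neqAle eq_sym; apply/andP; split; last first.
  by rewrite -(ltn_pmul2r t_gt0) mul0n dt.
by apply: contraNneq e_j0 => d1; rewrite -dt d1 mul1n t_dvd_e.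
Qed.

Let iz_inj : injective (fun j => iota (z j)).
Proof. by move=> i j /fmorph_inj/z_inj. Qed.

Let f_neq0 : f != 0. Proof. exact: prod_linear_neq0. Qed.

Let f00 : f.[0] != 0.
Proof.
rewrite horner_prod; apply/prodf_neq0 => j _.
by rewrite !hornerE subr0 expf_neq0 // fmorph_eq0.
Qed.

Let coprime_exponents u : (u %| d)%N -> (forall j, u %| e' j)%N -> u = 1%N.
Proof.
move=> ud ue; have : (u * t %| t)%N.
  apply: t_max => [|j]; first by rewrite -dt dvdn_pmul2r.
  by rewrite -e't dvdn_pmul2r.
by move/dvdn_leq => /(_ t_gt0); rewrite -{2}[t]mul1n leq_pmul2r //; case: u ud {ue} => [|[]] //;
  rewrite dvd0n => /eqP d0; move: d_gt1; rewrite d0.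
Qed.

Let mf := (\sum_j e' j)%N.

(** For Q = q^(2 nu) = y^2, the value at x is chi of f(x)^(t E), where t E = (Q - 1)/d. The sum is
    thus that of zeta^(t s) N_s over d classes; Stepanov bounds each N_s by Q/d + O(y), and
    [balanced_sum_bound] concludes. *)
Lemma Lsum_bound nu : (0 < nu)%N ->
  `|Lsum iota G (nu * 2)| <= (stepanov_const d mf + mf)%:R * (q ^ nu)%:R.
Proof.
move=> nu_gt0; set i := (nu * 2)%N; set y := (q ^ nu)%N.
have Qy : (q ^ i = y ^ 2)%N by rewrite /y expnM.
pose E := (\sum_(s < i) q ^ s)%N.
have nE : ((q ^ i).-1 = q.-1 * E)%N by exact: predn_exp.
have i_gt0 : (0 < i)%N by rewrite muln_gt0 nu_gt0.
have Q_gt0 : (0 < q ^ i)%N by rewrite expn_gt0 ltnW.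
have E_gt0 : (0 < E)%N by rewrite /E; case: (i) i_gt0 => // i' _; rewrite big_ord_recl.
have deQ : ((d * (t * E)).+1 = y ^ 2)%N by rewrite mulnA dt -nE prednK // Qy.
have qi1 : (1 < q ^ i)%N by rewrite -(expn0 q) ltn_exp2l.
have pQ : [pchar K].-nat (q ^ i)%N by rewrite pnatX pcharq.
set Om := fixed_points K (q ^ i).
have OmE x : x \in Om = (x ^+ (q ^ i) == x) := mem_fixed_points qi1 x.
have izq j : iota (z j) ^+ q = iota (z j) by rewrite -rmorphXn /= expf_card.
have frobX k a : a ^+ q = a -> a ^+ (q ^ k) = a :> K.
  by move=> aq; elim: k => [|k IH]; rewrite ?expn0 ?expr1 // expnS exprM aq.
have fQ x : x \in Om -> f.[x] ^+ (q ^ i) = f.[x].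
  rewrite OmE => /eqP xQ; rewrite horner_prod -prodrXl; apply: eq_bigr => j _.
  rewrite !hornerE -exprM mulnC exprM exprDn_pchar // exprNn_pchar // xQ.
  by rewrite frobX.
have Wd x : x \in Om -> f.[x] != 0 -> (f.[x] ^+ (t * E)) ^+ d = 1.
  move=> xOm fx; rewrite -exprM [X in _ ^+ X](_ : _ = (q ^ i).-1).
    by apply: (mulfI fx); rewrite -exprS prednK // fQ // mulr1.
  by rewrite nE -dt; ring.
have Wq x : x \in Om -> (f.[x] ^+ (t * E)) ^+ q = f.[x] ^+ (t * E).
  move=> xOm; have [->|fx] := eqVneq f.[x] 0.
    by rewrite expr0n muln_eq0 !gtn_eqF // expr0n gtn_eqF // ltnW.
  by rewrite -[X in _ ^+ X](prednK (ltnW q_gt1)) exprS -dt (exprM _ d t) Wd // expr1n mulr1.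
have GE x : x \in Om -> G (norm_poly iota i x) = chi (descend iota (f.[x] ^+ (t * E))).
  move=> xOm; have /eqP xQ : x ^+ (q ^ i) == x by rewrite -OmE.
  have -> : G (norm_poly iota i x) = chi (\prod_j (norm_poly iota i x).[z j] ^+ e j).
    rewrite /G /char_prod; apply: (big_ind2 (fun a b => a = chi b)).
    - by rewrite mult_char1.
    - by move=> a b a' b' -> ->; rewrite mult_charM.
    - by move=> j _; rewrite mult_charX.
  congr (chi _); apply: (fmorph_inj iota); rewrite descendK; last exact: Wq.
  rewrite rmorph_prod horner_prod -prodrXl; apply: eq_bigr => j _.
  rewrite rmorphXn /= -horner_map map_norm_poly // (horner_conj_prod _ _ pcharq (izq j)).
  by rewrite !hornerE -!exprM mulnA e't mulnC.
have f_pow x : x \in Om -> f.[x] != 0 -> exists s : 'I_d, f.[x] ^+ (t * E) = iota (g ^+ (t * s)).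
  move=> xOm fx; have [w0|w0] := eqVneq (descend iota (f.[x] ^+ (t * E))) 0.
    have := descendK iota (Wq x xOm); rewrite w0 rmorph0 => /esym/eqP.
    by rewrite expf_eq0 (negPf fx) andbF.
  have [k wk] := primitive_root_log g_prim w0.
  have Wk : f.[x] ^+ (t * E) = iota (g ^+ k) by rewrite -wk descendK ?Wq.
  have : g ^+ (k * d) == 1.
    by rewrite -(fmorph_eq1 iota) exprM rmorphXn /= -Wk Wd.
  rewrite -(prim_order_dvd g_prim) -dt [(k * d)%N]mulnC dvdn_pmul2l ?(ltnW d_gt1) //.
  move=> /dvdnP[k' kk'].
  exists (Ordinal (ltn_pmod k' (ltnW d_gt1))); rewrite Wk kk' /=.
  congr (iota _); apply/eqP; rewrite (eq_prim_root_expr g_prim) -dt muln_modr.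
  by rewrite [(d * t)%N]mulnC modn_mod mulnC.
have inj_pow (s s' : 'I_d) : g ^+ (t * s) = g ^+ (t * s') -> s = s'.
  move/eqP; rewrite (eq_prim_root_expr g_prim) -dt [(d * t)%N]mulnC -!muln_modr.
  by rewrite !modn_small // eqn_pmul2l // => /eqP/val_inj.
pose hit x (s : 'I_d) := (f.[x] != 0) && (f.[x] ^+ (t * E) == iota (g ^+ (t * s))).
have hit_sum (V : nmodType) (A : 'I_d -> V) x : x \in Om -> f.[x] != 0 ->
    exists2 s : 'I_d, f.[x] ^+ (t * E) = iota (g ^+ (t * s)) &
      \sum_(s < d) (if hit x s then A s else 0) = A s.
  move=> xOm fx; have [s sE] := f_pow x xOm fx; exists s => //.
  rewrite (bigD1 s) //= /hit fx sE eqxx /= big1 ?addr0 // => s' ss'.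
  by case: eqP => // /fmorph_inj/inj_pow e_ss'; rewrite e_ss' eqxx in ss'.
pose N (s : 'I_d) := size [seq x <- Om | hit x s].
have LE : Lsum iota G i = \sum_(s < d) zeta ^+ (t * s) * (N s)%:R.
  rewrite /Lsum -/Om; under [RHS]eq_bigr => s _.
    rewrite /N size_filter -sum1_count natr_sum mulr_sumr big_mkcond; over.
  rewrite exchange_big /= big_seq [RHS]big_seq; apply: eq_bigr => x xOm.
  under [RHS]eq_bigr do rewrite mulr1.
  rewrite GE //; have [fx|fx] := eqVneq f.[x] 0.
    have -> : f.[x] ^+ (t * E) = iota 0.
      by apply/eqP; rewrite rmorph0 expf_eq0 muln_gt0 t_gt0 E_gt0 fx eqxx.
    rewrite descendE mult_char0 //.
    by rewrite big1 // => s _; rewrite /hit fx eqxx.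
  have [s -> ->] := hit_sum _ (fun s => zeta ^+ (t * s)) x xOm fx.
  by rewrite descendE mult_char_exp.
have NB s : (d * N s <= y ^ 2 + stepanov_const d mf * y)%N.
  apply: (@stepanov_estimate K f (iota (g ^+ (t * s))) _ d (t * E) mf y) => //.
  - by rewrite ltnW.
  - by rewrite muln_gt0 t_gt0.
  - exact: size_prod_linear.
  - by move=> D a b u a0 b0 u0; apply: (prod_linear_not_power iz_inj coprime_exponents (ltnW d_gt1)).
  - by apply: dvdp_Xn_exp_sub; rewrite -Qy.
  - by rewrite -Qy.
  - by rewrite filter_uniq ?fixed_points_uniq.
  move=> a; rewrite mem_filter => /andP[/andP[fa /eqP fae]]; rewrite OmE => /eqP aQ.
  by split; rewrite -?Qy.
(* Every point outside the at most [mf] zeros of [f] falls in a class. *)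
have sumN : (y ^ 2 <= \sum_s N s + mf)%N.
  rewrite -Qy -[X in (X <= _)%N](size_fixed_points_eq qi1 pQ) -/Om.
  rewrite -(count_predC (fun x => f.[x] == 0) Om) addnC leq_add //; last first.
    rewrite -size_filter -[mf](size_prod_linear (fun j => iota (z j)) e') -ltnS prednK ?size_poly_gt0 //.
    apply: max_poly_roots => //; last by rewrite filter_uniq ?fixed_points_uniq.
    by apply/allP => x; rewrite mem_filter => /andP[].
  under eq_bigr => s _ do rewrite /N size_filter -sum1_count big_mkcond.
  rewrite exchange_big /= -sum1_count big_mkcond big_seq [X in (_ <= X)%N]big_seq.
  apply: leq_sum => x xOm /=; have [//|fx] := eqVneq f.[x] 0.
  by have [s _ ->] := hit_sum nat (fun=> 1%N) x xOm fx.
have d0 : (0 : C) < d%:R by rewrite ltr0n ltnW.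
rewrite -(ler_pM2l d0) LE.
apply: le_trans (balanced_sum_bound _ _ NB) _.
- move=> s; rewrite -(mult_char_exp g_prim zeta_prim) norm_mult_char // expf_neq0 //.
  by rewrite -(fmorph_eq0 iota) fmorph_eq0 (primitive_root_neq0 g_prim).
- have zt1 : zeta ^+ t != 1.
    rewrite -(prim_order_dvd zeta_prim) -dt; apply/negP => /dvdn_leq.
    by move=> /(_ t_gt0); rewrite -{2}[t]mul1n leq_pmul2r // leqNgt d_gt1.
  apply: (mulfI (_ : zeta ^+ t - 1 != 0)); first by rewrite subr_eq0.
  under eq_bigr do rewrite exprM.
  by rewrite -subrX1 -exprM mulnC dt (prim_expr_order zeta_prim) subrr mulr0.
rewrite -!natrM ler_nat -mulnBr leq_mul2l; apply/orP; right.
have y_gt0 : (0 < y)%N by rewrite expn_gt0 ltnW.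
rewrite leq_subLR mulnDl; apply: leq_trans (leq_add sumN (leqnn _)) _.
rewrite -addnA leq_add2l addnC leq_add2l.
by rewrite -{1}[mf]muln1 leq_mul2l y_gt0 orbT.
Qed.

End Extension.
Lemma Lcoef0 : Lcoef G 0 = 1.
Proof.
have E0 (a : 'rV[F]_0) : monic_of_row a = 1.
  by rewrite /monic_of_row [a]thinmx0 raddf0 addr0.
rewrite /Lcoef (eq_bigr (fun=> 1)) => [|a _]; last first.
  rewrite E0 /G /char_prod big1 // => j _.
  by rewrite hornerC mult_char1 ?expr1n.
by rewrite sumr_const card_mx muln0 expn0.
Qed.

Lemma Lcoef1 : Lcoef G 1 = \sum_x \prod_j chi (z j - x) ^+ e j.
Proof.
rewrite /Lcoef (reindex (fun x : F => const_mx (- x) : 'rV_1)) /=; last first.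
  exists (fun a : 'rV_1 => - a 0 0) => [x _|a _]; first by rewrite mxE opprK.
  by rewrite opprK; apply/rowP => i; rewrite mxE !ord1.
apply: eq_bigr => x _; apply: eq_bigr => j _; congr (chi _ ^+ _).
rewrite /monic_of_row hornerD hornerXn expr1; congr (_ + _).
rewrite (_ : rVpoly _ = (- x)%:P) ?hornerC //.
apply/polyP => k; rewrite coef_rVpoly coefC.
by case: insubP => [i _ <-|]; [rewrite mxE ord1 | case: k].
Qed.

Theorem weil_bound :
  `|\sum_x \prod_j chi (z j - x) ^+ e j| <= (m.-1)%:R * sqrtC q%:R.
Proof.
rewrite -Lcoef1.
have [K [iota _]] := countable_algebraic_closure F.
have [A LA] : exists A : nat, forall nu, (0 < nu)%N ->
    `|Lsum iota G (nu * 2)| <= A%:R * (q ^ nu)%:R.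
  by eexists => nu; apply: Lsum_bound.
have c_eq0 n : (m <= n)%N -> Lcoef G n = 0.
  move=> mn; apply: (@Lcoef_char_prod_eq0 _ _ _ z (fun j x => chi x ^+ e j) _ _ n j0 g) => //.
  - by move=> j x y; rewrite mult_charM // exprMn.
  - exact: primitive_root_neq0 g_prim.
  - rewrite -[g]expr1 mult_char_exp // expr1.
    by rewrite -(prim_order_dvd zeta_prim).
pose P := \poly_(n < m) Lcoef G n.
have PE n : P`_n = Lcoef G n by rewrite coef_poly; case: ltnP => // /c_eq0.
have [|ws PW sw] := @reciprocal_prodP _ P; first by rewrite PE Lcoef0.
(* Newton's identities for the coefficients of [P] hold for both sequences and determine them, as
   [P] has constant coefficient 1. *)
have SE i : (0 < i)%N -> Lsum iota G i = - \sum_(w <- ws) w ^+ i.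
  have [n] := ubnP i; elim: n i => // n IH i; rewrite ltnS => lin i0.
  have := Newton_Lcoef iota GM i; rewrite -PE PW Newton_power_sums -PW.
  rewrite big_nat_recr // big_nat_recr //= subnn PE Lcoef0 !mulr1 opprD -sumrN.
  rewrite [X in X + _ = _](eq_big_nat _ _ (F2 := fun k => Lsum iota G k * Lcoef G (i - k))).
    by move/addrI => <-.
  by move=> k /andP[k0 ki]; rewrite PE IH ?mulNr // (leq_trans ki).
(* Only even exponents are controlled; they are the power sums of the squares, whose growth rate q
   gives |w^2| <= q. *)
pose ws2 := [seq w ^+ 2 | w <- ws].
have q0 : 0 < q%:R :> C by rewrite ltr0n ltnW.
have wsB w : w \in ws -> `|w| <= sqrtC q%:R.
  move=> ww; have : `|w ^+ 2| <= q%:R.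
    apply: (@power_sum_bound C archiC ws2 (A + size ws)%:R) (map_f _ ww) => // k.
    rewrite big_map; under eq_bigr do rewrite -exprM mulnC.
    (* Exponent 0 lies outside [LA]; [size ws] was added to the constant for it. *)
    case: k => [|k].
      under eq_bigr do rewrite mul0n expr0.
      by rewrite big_const_seq iter_addr_0 count_predT normr_nat expr0 mulr1 ler_nat leq_addl.
    rewrite -normrN -SE //; apply: le_trans (LA _ _) _ => //.
    by rewrite -natrX -!natrM ler_nat leq_mul2r leq_addr orbT.
  rewrite normrX => le2; rewrite -[X in _ <= X]sqrtCK in le2.
  by move: le2; rewrite ler_pXn2r // nnegrE ?sqrtC_ge0 ?normr_ge0 ?(ltW q0).
have -> : Lcoef G 1 = - \sum_(w <- ws) w ^+ 1.
  by have := Newton_Lcoef iota GM 1; rewrite mulr1n big_nat1 subnn Lcoef0 mulr1 SE.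
rewrite normrN; apply: le_trans (ler_norm_sum _ _ _) _.
apply: (@le_trans _ _ (\sum_(w <- ws) sqrtC q%:R)).
  by rewrite big_seq [X in _ <= X]big_seq; apply: ler_sum => w ww; rewrite expr1 wsB.
rewrite big_const_seq iter_addr_0 count_predT -[X in X <= _]mulr_natl.
rewrite ler_wpM2r ?sqrtC_ge0 ?(ltW q0) //.
rewrite ler_nat sw -!subn1 leq_sub2r //; exact: size_poly.
Qed.

End WeilBound.

(** * Counting progressions *)

Section ProgressionCount.
Variables (F : finFieldType) (C : numClosedFieldType) (g : F) (zeta : C).
Local Notation q := #|F|.
Local Notation n := (q.-1).
Hypotheses (g_prim : n.-primitive_root g) (zeta_prim : n.-primitive_root zeta).
Hypothesis archiC : forall x : C, 0 <= x -> exists n : nat, x < n%:R.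
Local Notation chi := (mult_char g zeta).

Let n_gt0 : (0 < n)%N := prim_order_gt0 g_prim.

Lemma mult_char_full x : x != 0 -> chi x ^+ n = 1.
Proof.
move=> /(primitive_root_log g_prim)[i ->].
by rewrite mult_char_exp // -exprM mulnC exprM (prim_expr_order zeta_prim) expr1n.
Qed.

Lemma mult_char_eq1 x : chi x = 1 -> x = 1.
Proof.
have [->|] := eqVneq x 0; first by rewrite mult_char0 // => /eqP; rewrite eq_sym oner_eq0.
move=> /(primitive_root_log g_prim)[i ->]; rewrite mult_char_exp // => /eqP.
by rewrite -(prim_order_dvd zeta_prim) (prim_order_dvd g_prim) => /eqP.
Qed.

(** Exponents run over 1..n rather than 0..n-1, so that the trivial character is chi^n, which
    vanishes at 0; the identity then covers x = 0. *)
Lemma sum_char_orthogonal x :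
  \sum_(s < n) chi x ^+ s.+1 = if x == 1 then n%:R else 0.
Proof.
case: eqP => [->|/eqP x1].
  by under eq_bigr do rewrite mult_char1 // expr1n; rewrite sumr_const card_ord.
under eq_bigr do rewrite exprS; rewrite -mulr_sumr.
have [->|x0] := eqVneq x 0; first by rewrite mult_char0 // mul0r.
have chi1 : chi x - 1 != 0 by rewrite subr_eq0; apply: contra_neq x1; apply: mult_char_eq1.
by rewrite [X in _ * X](_ : _ = 0) ?mulr0 //; apply: (mulfI chi1); rewrite -subrX1 mult_char_full // subrr mulr0.
Qed.

(** The conjugate of a character sum over A; the inverses make orthogonality detect x = a b. *)
Definition set_char_sum (A : {set F}) (s : nat) : C := \sum_(a in A) chi a^-1 ^+ s.+1.

Lemma conj_mult_char x : (chi x)^* = chi x^-1.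
Proof.
have [->|x0] := eqVneq x 0; first by rewrite invr0 mult_char0 // conjC0.
have chi0 : chi x != 0 by rewrite -normr_gt0 norm_mult_char // ltr01.
apply: (mulfI chi0); rewrite -normCK norm_mult_char // expr1n.
by rewrite -mult_charM // mulfV // mult_char1.
Qed.

Lemma parseval_set_char_sum (A : {set F}) : 0 \notin A ->
  \sum_(s < n) `|set_char_sum A s| ^+ 2 = (n * #|A|)%:R.
Proof.
move=> A0; have sqE s : `|set_char_sum A s| ^+ 2 =
    \sum_(a in A) \sum_(b in A) chi (a^-1 * b) ^+ s.+1.
  rewrite normCK rmorph_sum mulr_suml; apply: eq_bigr => a _.
  rewrite mulr_sumr; apply: eq_bigr => b _.
  by rewrite rmorphXn /= conj_mult_char invrK mult_charM // exprMn.
under eq_bigr do rewrite sqE.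
rewrite exchange_big /= mulnC natrM mulr_natl -sumr_const; apply: eq_bigr => a aA.
rewrite exchange_big /=; have a0 : a != 0 by apply: contraNneq A0 => <-.
under eq_bigr do rewrite sum_char_orthogonal.
rewrite (bigD1 a) //= mulVf // eqxx big1 ?addr0 // => b /andP[_ ba].
by case: eqP => // /(congr1 (fun x => a * x)); rewrite mulVKf // mulr1 => e; rewrite e eqxx in ba.
Qed.

(** Cauchy-Schwarz as a weighted inequality of means: the weights #B and #A equalize the two
    Parseval sums. *)
Lemma sum_norm_product_bound (A B : {set F}) (w : C) : 0 \notin A -> 0 \notin B ->
  0 < w -> w ^+ 2 = (#|A| * #|B|)%:R ->
  \sum_(s < n) `|set_char_sum A s * set_char_sum B s| <= n%:R * w.
Proof.
move=> A0 B0 w0 wE.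
pose u := sqrtC (#|A|%:R : C); pose v := sqrtC (#|B|%:R : C).
have u0 : 0 <= u by rewrite sqrtC_ge0.
have v0 : 0 <= v by rewrite sqrtC_ge0.
have wuv : w = u * v.
  have := ltW w0; rewrite -[w]sqrCK ?(ltW w0) // wE natrM rootCMl ?ler0n //.
have AGM s : 2 * w * `|set_char_sum A s * set_char_sum B s| <=
   v ^+ 2 * `|set_char_sum A s| ^+ 2 + u ^+ 2 * `|set_char_sum B s| ^+ 2.
  have agm (a b : C) : 0 <= a -> 0 <= b ->
      2 * (u * v) * (a * b) <= v ^+ 2 * a ^+ 2 + u ^+ 2 * b ^+ 2.
    move=> a0 b0; rewrite -subr_ge0.
    rewrite [X in 0 <= X](_ : _ = (v * a - u * b) ^+ 2); last by ring.
    by apply: real_exprn_even_ge0; rewrite // rpredB // ger0_real // mulr_ge0.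
  by rewrite normrM wuv agm.
have : 2 * w * \sum_(s < n) `|set_char_sum A s * set_char_sum B s| <= 2 * w * (n%:R * w).
  rewrite mulr_sumr; apply: (@le_trans _ _ (\sum_(s < n) (v ^+ 2 * `|set_char_sum A s| ^+ 2 +
      u ^+ 2 * `|set_char_sum B s| ^+ 2))); first by apply: ler_sum => s _; exact: AGM.
  rewrite big_split /= -!mulr_sumr !parseval_set_char_sum // !sqrtCK.
  rewrite [X in _ <= X](_ : _ = 2 * n%:R * w ^+ 2); last by ring.
  by rewrite wE !natrM le_eqVlt; apply/orP; left; apply/eqP; ring.
by rewrite ler_pM2l // mulr_gt0.
Qed.
Lemma sum_char_notin_productset (A B : {set F}) x : 0 \notin A -> 0 \notin B ->
  x \notin productset A B ->
  \sum_(s < n) chi x ^+ s.+1 * (set_char_sum A s * set_char_sum B s) = 0.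
Proof.
move=> A0 B0 xAB.
transitivity (\sum_(a in A) \sum_(b in B) \sum_(s < n) chi (x * (a^-1 * b^-1)) ^+ s.+1).
  under [RHS]eq_bigr do rewrite exchange_big /=.
  rewrite [RHS]exchange_big /=; apply: eq_bigr => s _.
  rewrite mulr_suml mulr_sumr; apply: eq_bigr => a _.
  rewrite mulr_sumr mulr_sumr; apply: eq_bigr => b _.
  by rewrite !mult_charM // !exprMn.
rewrite big1 // => a aA; rewrite big1 // => b bB; rewrite sum_char_orthogonal.
have a0 : a != 0 by apply: contraNneq A0 => <-.
have b0 : b != 0 by apply: contraNneq B0 => <-.
case: eqP => // xab; case/negP: xAB; apply/imset2P; exists a b => //.
by rewrite -[RHS]mul1r -xab; field; rewrite a0 b0.
Qed.

(** On the right, (n w)^K bounds the mass of all K-tuples of characters, and the share of the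
    trivial tuple is subtracted. [n - K] bounds from below the number of x != 0 off the K nodes; the
    + 1 pays for x = 0, which Weil's complete sum includes. *)
Lemma no_progression_bound (A B : {set F}) (p K : nat) (x0 : F) (w : C) :
  p \in [pchar F] -> (0 < K < p)%N -> 0 \notin A -> 0 \notin B -> x0 != 0 ->
  0 < w -> w ^+ 2 = (#|A| * #|B|)%:R ->
  (forall x, x != 0 -> exists j : 'I_K, x0 * (1 + j.+1%:R * x) \notin productset A B) ->
  (w ^+ 2) ^+ K * (n - K)%:R <=
    ((K.-1)%:R * sqrtC q%:R + 1) * ((n%:R * w) ^+ K - (w ^+ 2) ^+ K).
Proof.
move=> pF /andP[K0 Kp] A0 B0 x00 w0 wE no_prog.
pose rho s := set_char_sum A s * set_char_sum B s.
pose T (phi : {ffun 'I_K -> 'I_n}) :=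
  \sum_(x | x != 0) \prod_(j < K) chi (x0 * (1 + j.+1%:R * x)) ^+ (phi j).+1.
have sum0 : \sum_(phi : {ffun 'I_K -> 'I_n}) (\prod_j rho (phi j)) * T phi = 0.
  transitivity (\sum_(x | x != 0)
     \prod_(j < K) \sum_(s < n) chi (x0 * (1 + j.+1%:R * x)) ^+ s.+1 * rho s).
    under [RHS]eq_bigr do rewrite bigA_distr_bigA /=.
    rewrite [RHS]exchange_big /=; apply: eq_bigr => phi _.
    rewrite mulr_sumr; apply: eq_bigr => x _.
    by rewrite mulrC -big_split.
  apply: big1 => x x0'; have [j jP] := no_prog x x0'.
  by rewrite (bigD1 j) //= sum_char_notin_productset // mul0r.
(* x0 (1 + (j + 1) x) = c_j (z_j - x) with z_j = -1/(j + 1); K < p makes the nodes meaningful and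
   distinct. *)
pose z (j : 'I_K) : F := - (j.+1%:R)^-1.
have jR0 (j : 'I_K) : j.+1%:R != 0 :> F.
  rewrite -(dvdn_pcharf pF); apply/negP => /dvdn_leq => /(_ isT).
  by rewrite leqNgt (leq_ltn_trans (ltn_ord j)).
have z0 j : z j != 0 by rewrite oppr_eq0 invr_eq0.
have z_inj : injective z.
  move=> i j /oppr_inj/invr_inj/eqP.
  wlog ij : i j / (i <= j)%N => [th|].
    by case: (leqP i j) => [/th//|/ltnW/th h]; rewrite eq_sym => /h.
  rewrite eq_sym -subr_eq0 -natrB // subSS -(dvdn_pcharf pF) => pd.
  apply/val_inj/eqP; rewrite eqn_leq ij -subn_eq0; move: pd.
  case: (posnP (j - i)) => [->//|ji0] /dvdn_leq => /(_ ji0).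
  by rewrite leqNgt (leq_ltn_trans (leq_subr _ _)) // (leq_trans (ltn_ord j)) // ltnW.
pose c (j : 'I_K) := x0 * - j.+1%:R.
have c0 j : c j != 0 by rewrite mulf_neq0 // oppr_eq0.
have yE (j : 'I_K) x : x0 * (1 + j.+1%:R * x) = c j * (z j - x).
  by rewrite /c /z; move: (jR0 j); move: (j.+1%:R) => r r0; field.
have nlast : (n.-1 < n)%N by rewrite prednK.
(* Exponents being shifted by one, the trivial character has the last index n - 1. *)
pose phi0 : {ffun 'I_K -> 'I_n} := [ffun=> Ordinal nlast].
have phi0E j : (phi0 j).+1 = n by rewrite ffunE /= prednK.
have T0 : (n - K)%:R <= T phi0.
  pose D := ~: (0 |: [set z j | j : 'I_K]).
  have -> : T phi0 = #|D|%:R.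
    rewrite -sumr_const /T [LHS]big_mkcond [RHS]big_mkcond; apply: eq_bigr => x _.
    rewrite !inE negb_or; case: (x =P 0) => //= _.
    have [/imsetP[j _ ->]|xz] := boolP (x \in _).
      by rewrite (bigD1 j) //= yE subrr mulr0 mult_char0 // expr0n mul0r.
    rewrite big1 // => j _; rewrite phi0E mult_char_full // yE mulf_neq0 // subr_eq0.
    by apply: contraNneq xz => <-; apply: imset_f.
  have cD : (#|0%R |: [set z j | j : 'I_K]| <= 1 + K)%N.
    rewrite cardsU1; apply: leq_add; first by case: (_ \notin _).
    by rewrite -[X in (_ <= X)%N](card_ord K); apply: leq_imset_card.
  by rewrite ler_nat cardsCs setCK -subn1 -subnDA leq_sub2l.
set Err := _ + 1.
have TB phi : phi != phi0 -> `|T phi| <= Err.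
  move=> phi_neq; have [j jphi] : exists j, ~~ (n %| (phi j).+1)%N.
    apply/existsP; apply: contraNT phi_neq => /existsPn phin.
    apply/eqP/ffunP => j; apply/val_inj/succn_inj; rewrite [RHS]phi0E.
    have := phin j; rewrite negbK => /dvdn_leq => /(_ isT) nle.
    by apply/eqP; rewrite eqn_leq nle ltn_ord.
  have normc : `|\prod_(j < K) chi (c j) ^+ (phi j).+1| = 1.
    by rewrite normr_prod big1 // => i _; rewrite normrX norm_mult_char // expr1n.
  have weil := weil_bound (e := fun j => (phi j).+1) g_prim zeta_prim archiC z_inj z0 jphi.
  have -> : T phi = (\prod_(j < K) chi (c j) ^+ (phi j).+1) *
      (\sum_x \prod_j chi (z j - x) ^+ (phi j).+1) -
      \prod_(j < K) chi (x0 * (1 + j.+1%:R * 0)) ^+ (phi j).+1.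
    rewrite mulr_sumr (bigD1 0) //= [X in X + _ - _](_ : _ =
      \prod_(j < K) chi (x0 * (1 + j.+1%:R * 0)) ^+ (phi j).+1); last first.
      by rewrite -big_split; apply: eq_bigr => i _; rewrite /= yE mult_charM // exprMn.
    rewrite addrAC subrr add0r; apply: eq_bigr => x _.
    by rewrite -big_split; apply: eq_bigr => i _; rewrite /= yE mult_charM // exprMn.
  apply: le_trans (ler_normB _ _) _; apply: lerD; first by rewrite normrM normc mul1r.
  rewrite normr_prod big1 // => i _.
  by rewrite mulr0 addr0 mulr1 normrX norm_mult_char // expr1n.
have rho_last : \prod_(j < K) rho (phi0 j) = (w ^+ 2) ^+ K.
  have setE (D : {set F}) : 0 \notin D -> set_char_sum D n.-1 = #|D|%:R.
    move=> D0; rewrite /set_char_sum prednK // -sumr_const; apply: eq_bigr => a aD.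
    by rewrite mult_char_full // invr_eq0; apply: contraNneq D0 => <-.
  rewrite (eq_bigr (fun=> w ^+ 2)) ?prodr_const ?card_ord // => j _.
  by rewrite ffunE /rho /= !setE // wE natrM.
have rho_sum : \sum_(phi : {ffun 'I_K -> 'I_n}) `|\prod_j rho (phi j)| <= (n%:R * w) ^+ K.
  under eq_bigr do rewrite normr_prod.
  rewrite -(bigA_distr_bigA (fun _ (s : 'I_n) => `|rho s|)) /= prodr_const card_ord.
  have nw0 : 0 <= n%:R * w by rewrite mulr_ge0 // ltW.
  apply: lerXn2r; rewrite ?nnegrE ?sumr_ge0 //.
  exact: sum_norm_product_bound.
have Err0 : 0 <= Err by rewrite addr_ge0 ?mulr_ge0 ?sqrtC_ge0.
have w2K : 0 <= (w ^+ 2) ^+ K by rewrite !exprn_ge0 // ltW.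
move: sum0; rewrite (bigD1 phi0) //= rho_last => /eqP; rewrite addr_eq0 => /eqP main.
apply: (@le_trans _ _ `|(w ^+ 2) ^+ K * T phi0|).
  by rewrite normrM (ger0_norm w2K) ler_wpM2l // ger0_norm // (le_trans _ T0).
rewrite main normrN; apply: le_trans (ler_norm_sum _ _ _) _.
apply: (@le_trans _ _ (Err * \sum_(phi | phi != phi0) `|\prod_j rho (phi j)|)).
  rewrite mulr_sumr; apply: ler_sum => phi phin.
  by rewrite normrM mulrC ler_wpM2r // TB.
rewrite ler_wpM2l // lerBrDr; apply: le_trans rho_sum.
by rewrite [X in _ <= X](bigD1 phi0) //= rho_last ger0_norm // addrC.
Qed.

End ProgressionCount.

(** * The numerical inequality *)

Lemma bernoulli_inequality (R : realFieldType) (x : R) k :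
  0 <= x <= 1 -> 1 - k%:R * x <= (1 - x) ^+ k.
Proof.
move=> /andP[x0 x1]; elim: k => [|k IH]; first by rewrite expr0 mul0r subr0.
rewrite exprS; apply: (@le_trans _ _ ((1 - x) * (1 - k%:R * x))).
  by have := ler0n R k; rewrite -[k.+1]addn1 natrD; nra.
by rewrite ler_wpM2l // subr_ge0.
Qed.

(** Put n = y^2 - 1 and s = (w/n)^K. Divided by n^(2K) s, the claim reads Err (1 - s) < s (n - K),
    and Err <= K y reduces it to K y < s X with X = n - K + K y = (y - 1)(y + 1 + K). The hypothesis
    only gives s about K/y, so both sides agree to leading order and every loss must be tracked. *)
Lemma density_beats_error (R : realFieldType) (K : nat) (a b y w : R) :
  (2 <= K)%N -> K%:R + 2 <= y ^+ 2 -> 0 <= y -> 0 <= a <= y ^+ 2 -> 0 <= b <= y ^+ 2 ->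
  K%:R ^+ 2 * (y ^+ 4) ^+ K <= (a * b) ^+ K * y ^+ 2 ->
  0 < w -> (a - 1) * (b - 1) <= w ^+ 2 ->
  ((K.-1)%:R * y + 1) * (((y ^+ 2 - 1) * w) ^+ K - (w ^+ 2) ^+ K) <
    (w ^+ 2) ^+ K * (y ^+ 2 - 1 - K%:R).
Proof.
move=> K2 Ky y0 /andP[a0 aq] /andP[b0 bq] dens w0 wab.
have Kpos : (0 < K)%N by exact: ltnW.
have K2R : 2 <= K%:R :> R by rewrite ler_nat.
have y2 : 2 <= y by nra.
pose n := y ^+ 2 - 1; have n0 : 0 < n by rewrite /n; nra.
have yp : 0 < y by lra.
pose delta := a * b / y ^+ 4.
have y4 : 0 < y ^+ 4 by rewrite exprn_gt0.
have dK : (K%:R / y) ^+ 2 <= delta ^+ K.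
  rewrite /delta !expr_div_n ler_pdivrMr ?exprn_gt0 // mulrAC ler_pdivlMr ?exprn_gt0 //.
have d1 : delta <= 1.
  rewrite ler_pdivrMr // mul1r; have -> : y ^+ 4 = y ^+ 2 * y ^+ 2 by ring.
  exact: ler_pM.
have d0 : 0 <= delta by rewrite divr_ge0 ?mulr_ge0 // ltW.
have r0 : 0 < K%:R / y by rewrite divr_gt0 //; lra.
have r1 : K%:R / y <= 1.
  rewrite -(@expr_le1 _ 2) ?(ltW r0) //; apply: le_trans dK _.
  by rewrite exprn_ile1.
(* (K/y)^2 >= (K/y)^K, because K >= 2 and K/y <= 1. *)
have dr : K%:R / y <= delta.
  rewrite leNgt; apply/negP => dlt; have : delta ^+ K < (K%:R / y) ^+ K.
    by rewrite ltrXn2r // -lt0n.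
  rewrite ltNge => /negP; apply; apply: le_trans dK.
  by apply: ler_wiXn2l => //; rewrite ltW.
have Kley : K%:R <= y by move: r1; rewrite ler_pdivrMr // mul1r.
(* Relative loss from removing 0 from both sets, chosen so that delta (1 - tau) n = delta y^2 -
   delta y/K, where delta y/K >= 1 by [dr]. *)
pose tau := (y / K%:R - 1) / n.
have K0 : 0 < K%:R :> R by lra.
have tau0 : 0 <= tau.
  apply: divr_ge0; last exact: ltW.
  by rewrite subr_ge0 ler_pdivlMr // mul1r.
have Ktau : K%:R * tau <= 1 / (y + 1).
  have -> : K%:R * tau = (y - K%:R) / n by rewrite /tau; field; rewrite !gt_eqF.
  rewrite ler_pdivrMr // mulrAC ler_pdivlMr; last by lra.
  by rewrite mul1r /n; nra.
have tau1 : tau <= 1.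
  have : 1 / (y + 1) <= 1 by rewrite ler_pdivrMr; lra.
  nra.
have vd : delta * (1 - tau) <= w ^+ 2 / n ^+ 2.
  have dy : 1 <= delta * (y / K%:R).
    by rewrite mulrA ler_pdivlMr // mul1r -ler_pdivrMr.
  (* With (a - 1)(b - 1) in place of w^2, the two sides differ by (y^2 - a)(y^2 - b). *)
  have nw : n * (a * b - y ^+ 2) <= y ^+ 2 * w ^+ 2.
    apply: le_trans (_ : y ^+ 2 * ((a - 1) * (b - 1)) <= _); last by rewrite ler_wpM2l // sqr_ge0.
    by rewrite /n; nra.
  rewrite ler_pdivlMr ?exprn_gt0 // expr2 mulrA.
  have -> : delta * (1 - tau) * n = delta * (n + 1) - delta * (y / K%:R).
    by rewrite /tau; field; rewrite !gt_eqF.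
  apply: (@le_trans _ _ ((delta * y ^+ 2 - 1) * n)).
    by rewrite ler_wpM2r ?(ltW n0) // /n subrK lerB.
  rewrite -(@ler_pM2l _ (y ^+ 2)) ?exprn_gt0 //.
  rewrite [X in X <= _](_ : _ = n * (a * b - y ^+ 2)) // /delta.
  by field; rewrite gt_eqF.
have vK : (K%:R / y) ^+ 2 * (y / (y + 1)) <= (w ^+ 2 / n ^+ 2) ^+ K.
  apply: (@le_trans _ _ (delta ^+ K * (1 - tau) ^+ K)); last first.
    have td0 : 0 <= delta * (1 - tau) by rewrite mulr_ge0 // subr_ge0.
    rewrite -exprMn; apply: lerXn2r => //; rewrite nnegrE //.
    exact: le_trans td0 vd.
  apply: ler_pM => //; first by rewrite sqr_ge0.
    by rewrite divr_ge0 //; lra.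
  apply: le_trans (bernoulli_inequality K _); last by rewrite tau0.
  have -> : y / (y + 1) = 1 - 1 / (y + 1) by field; rewrite gt_eqF //; lra.
  by rewrite lerB.
pose s := (w / n) ^+ K.
have s0 : 0 < s by rewrite exprn_gt0 // divr_gt0.
have s2 : s ^+ 2 = (w ^+ 2 / n ^+ 2) ^+ K by rewrite -exprM mulnC exprM expr_div_n.
pose X := n - K%:R + K%:R * y.
have X0 : (y - 1) * (y + 3) <= X by rewrite /X /n; nra.
have key : K%:R * y < s * X.
  have s2b : (K%:R / y) ^+ 2 * (y / (y + 1)) <= s ^+ 2 by rewrite s2.
  have y1 : 0 < y - 1 by lra.
  have X00 : 0 < (y - 1) * (y + 3) by rewrite mulr_gt0 //; lra.
  have Xy : y ^+ 3 * (y + 1) < X ^+ 2.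
    apply: (@lt_le_trans _ _ (((y - 1) * (y + 3)) ^+ 2)); last first.
      by rewrite lerXn2r ?nnegrE ?(ltW X00) // (le_trans (ltW X00)).
    (* Since y >= 2, substituting y = 2 + t leaves a polynomial with positive coefficients. *)
    rewrite -subr_gt0; have [t -> t0] : exists2 t, y = 2 + t & 0 <= t.
      by exists (y - 2); lra.
    rewrite [X in 0 < X](_ : _ = 1 + 16 * t + 16 * t ^+ 2 + 3 * t ^+ 3); last by ring.
    have := exprn_ge0 2 t0; have := exprn_ge0 3 t0; lra.
  have sX0 : 0 <= s * X by rewrite mulr_ge0 ?(ltW s0) // (le_trans (ltW X00)).
  have Ky0 : 0 <= K%:R * y by rewrite mulr_ge0.
  rewrite -(@ltr_pXn2r _ 2) ?nnegrE // exprMn [ltRHS]exprMn.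
  apply: (@lt_le_trans _ _ ((K%:R / y) ^+ 2 * (y / (y + 1)) * X ^+ 2)); last first.
    by rewrite ler_wpM2r // sqr_ge0.
  have -> : K%:R ^+ 2 * y ^+ 2 = (K%:R / y) ^+ 2 * (y / (y + 1)) * (y ^+ 3 * (y + 1)).
    by field; rewrite !gt_eqF //; lra.
  by rewrite ltr_pM2l // mulr_gt0 ?exprn_gt0 // divr_gt0 //; lra.
have wK : (w ^+ 2) ^+ K = (n ^+ K) ^+ 2 * s ^+ 2.
  rewrite -exprMn /s -exprMn mulrC divfK ?gt_eqF //.
  by rewrite -!exprM mulnC.
have nwK : (n * w) ^+ K = (n ^+ K) ^+ 2 * s.
  rewrite /s expr2 -mulrA -!exprMn; congr (_ ^+ K); field; rewrite gt_eqF //.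
rewrite -/n nwK wK -mulrBr mulrCA -mulrA ltr_pM2l ?exprn_gt0 //.
set Err := _ + 1.
have ErrK : Err <= K%:R * y.
  by rewrite /Err -[in leRHS](prednK Kpos) -natr1 mulrDl mul1r lerD2l; lra.
have nK : 1 <= n - K%:R by rewrite /n; lra.
rewrite [X in X < _](_ : _ = s * (Err * (1 - s))); last by ring.
rewrite expr2 -mulrA ltr_pM2l //.
move: key; rewrite /X; have Err0 : 0 <= Err.
  by rewrite addr_ge0 // mulr_ge0.
by case: (leP s 1) => s1; nra.
Qed.

(** * From real exponents and complex sums to the conclusion *)

Lemma complex_archimedean (R : realType) (x : R[i]) : 0 <= x -> exists n : nat, x < n%:R.
Proof.
move=> x0; have xE := RRe_real (ger0_real x0).
exists (Num.truncn (complex.Re x)).+1.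
rewrite -xE -(rmorph_nat (real_complex R)) ltcR.
by apply: truncnS_gt.
Qed.

(** Taking K-th powers and multiplying by q clears the real exponents. *)
Lemma density_powR (R : realType) (K q : nat) (c : R) : (0 < K)%N -> (0 < q)%N ->
  K%:R `^ (2 / K%:R) * q%:R `^ (2 - 1 / K%:R) <= c ->
  K%:R ^+ 2 * (q%:R ^+ 2) ^+ K <= c ^+ K * q%:R.
Proof.
move=> K0 q0 le_c; have KR : K%:R != 0 :> R by rewrite pnatr_eq0 -lt0n.
have qR : q%:R != 0 :> R by rewrite pnatr_eq0 -lt0n.
have lK : (K%:R `^ (2 / K%:R) * q%:R `^ (2 - 1 / K%:R)) ^+ K <= c ^+ K.
  have l0 : 0 <= K%:R `^ (2 / K%:R) * q%:R `^ (2 - 1 / K%:R) :> R.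
    by rewrite mulr_ge0 ?powR_ge0.
  by apply: lerXn2r => //; rewrite nnegrE // (le_trans l0).
have -> : K%:R ^+ 2 * (q%:R ^+ 2) ^+ K =
    (K%:R `^ (2 / K%:R) * q%:R `^ (2 - 1 / K%:R)) ^+ K * q%:R :> R.
  have powX (x r : R) : (x `^ r) ^+ K = x `^ (r * K%:R).
    by rewrite -powR_mulrn ?powR_ge0 // powRrM.
  have qpow : q%:R `^ (2 * K%:R - 1) * q%:R = (q%:R ^+ 2) ^+ K :> R.
    rewrite -[X in _ * X]powRr1 // -powRD ?qR ?implybT // subrK -natrM powR_mulrn //.
    by rewrite exprM.
  rewrite [in RHS]exprMn !powX divfK // powR_mulrn // mulrBl divfK // -qpow.
  by rewrite mulrA.
by rewrite ler_wpM2r.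
Qed.

Theorem theorem1 (R : realType) (F : finFieldType) (p k : nat)
    (hp : p \in [pchar F]) (hk3 : (3 <= k)%N) (hkp : (k < p)%N)
    (A B : {set F})
    (hAB : (k%:R - 1) `^ (2 / (k%:R - 1)) * #|F|%:R `^ (2 - 1 / (k%:R - 1))
             <= #|A|%:R * #|B|%:R :> R) :
  contains_AP k (productset A B).
Proof.
case: k hk3 hkp hAB => // K K2 Kp.
rewrite -addn1 natrD addrK => hAB.
have q0 : (0 < #|F|)%N by apply: ltnW (card_field_gt1 F).
have K0 : (0 < K)%N by apply: ltnW (K2 : (1 < K)%N).
have dens := density_powR K0 q0 hAB.
have pq : (p <= #|F|)%N.
  have := pprimeChar_pgroup hp; rewrite /pgroup cardsT => /p_natP[[|l] /= qE].
    by have := card_field_gt1 F; rewrite qE.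
  by rewrite qE -{1}[p]expn1 leq_exp2l // prime_gt1 // (pcharf_prime hp).
set q : R := #|F|%:R in dens.
have qK : K%:R + 2 <= q by rewrite -(natrD _ K 2) ler_nat addn2 (leq_trans Kp pq).
pose a : R := #|A|%:R; pose b : R := #|B|%:R.
have aq : 0 <= a <= q by rewrite ler0n ler_nat max_card.
have bq : 0 <= b <= q by rewrite ler0n ler_nat max_card.
pose A' := A :\ 0; pose B' := B :\ 0.
have A'a : a - 1 <= #|A'|%:R.
  by rewrite lerBlDr -(natrD _ _ 1) ler_nat (cardsD1 0 A) addnC leq_add2l; case: (_ \in _).
have B'b : b - 1 <= #|B'|%:R.
  by rewrite lerBlDr -(natrD _ _ 1) ler_nat (cardsD1 0 B) addnC leq_add2l; case: (_ \in _).
(* With a, b <= q this forces a, b > 1, so both sets contain a nonzero element. *)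
have ab_gt : q < a * b.
  rewrite ltNge; apply/negP => abq; move: dens; apply/negP; rewrite -ltNge.
  apply: (@le_lt_trans _ _ (q ^+ K * q)).
    by rewrite ler_wpM2r // lerXn2r ?nnegrE ?mulr_ge0.
  have q1 : 1 <= q by rewrite ler1n.
  have qqK : q <= q ^+ K by apply: ler_eXnr.
  have qK0 : 0 < q ^+ K by rewrite exprn_gt0 // ltr0n.
  have K2R : 2 <= K%:R :> R by rewrite ler_nat.
  apply: (@le_lt_trans _ _ (q ^+ K * q ^+ K)); first by rewrite ler_wpM2l // ltW.
  rewrite -exprM [(2 * K)%N]mulnC exprM expr2 -[X in X < _]mul1r ltr_pM2r ?mulr_gt0 //.
  by nra.
have a1 : 1 < a by case/andP: aq => *; case/andP: bq => *; nra.
have b1 : 1 < b by case/andP: aq => *; case/andP: bq => *; nra.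
have A'0 : (0 < #|A'|)%N by rewrite -(ltr0n R); lra.
have B'0 : (0 < #|B'|)%N by rewrite -(ltr0n R); lra.
have /card_gt0P[a0 a0A] := A'0; have /card_gt0P[b0 b0B] := B'0.
have x0 : a0 * b0 != 0.
  by move: a0A b0B; rewrite !inE => /andP[? _] /andP[? _]; rewrite mulf_neq0.
have subAB x : x \in productset A' B' -> x \in productset A B.
  case/imset2P => u v; rewrite !inE => /andP[_ uA] /andP[_ vB] ->.
  by apply/imset2P; exists u v.
have [/existsP[x /andP[xn0 /forallP xP]]|no_prog] := boolP [exists x, (x != 0) &&
    [forall j : 'I_K, a0 * b0 * (1 + j.+1%:R * x) \in productset A' B']].
  (* The term j = 0 is a0 b0 itself; the choice of x serves the K others. *)
  exists (a0 * b0), (a0 * b0 * x); split=> [|j]; first by rewrite mulf_neq0.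
  rewrite addn1 => jK; apply: subAB.
  case: j jK => [_|j jK]; first by rewrite mulr0n addr0; apply/imset2P; exists a0 b0.
  have := xP (Ordinal (jK : (j < K)%N)); rewrite /= mulrDr mulr1.
  by rewrite -[in X in _ -> X]mulr_natl mulrCA.
exfalso.
have [g g_prim] := finField_primitive_root F.
have [zeta zeta_prim] := exists_primitive_root R[i] (prim_order_gt0 g_prim).
(* The roots are taken in R and embedded in R[i], so that the complex bound descends to a real
   one. *)
pose y := Num.sqrt q; pose w : R := Num.sqrt (#|A'|%:R * #|B'|%:R).
have P0 : 0 < #|A'|%:R * #|B'|%:R :> R by rewrite mulr_gt0 // ltr0n.
have y2 : y ^+ 2 = q by rewrite sqr_sqrtr // ler0n.
have w2 : w ^+ 2 = #|A'|%:R * #|B'|%:R by rewrite sqr_sqrtr // ltW.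
have w0 : 0 < w by rewrite sqrtr_gt0.
have sq : sqrtC (#|F|%:R) = (y%:C)%C :> R[i].
  rewrite -(rmorph_nat (real_complex R)) -/q -y2 rmorphXn /= sqrCK //.
  by rewrite ler0c sqrtr_ge0.
have KF : (K <= #|F|.-1)%N.
  by rewrite -ltnS prednK // (leq_trans _ pq) // ltnW.
have wC : 0 < (w%:C)%C by rewrite ltcR.
have wE : (w%:C)%C ^+ 2 = (#|A'| * #|B'|)%:R.
  by rewrite -rmorphXn /= w2 -natrM rmorph_nat.
have np x : x != 0 -> exists j : 'I_K, a0 * b0 * (1 + j.+1%:R * x) \notin productset A' B'.
  by move=> xn0; apply/existsP; move/existsPn/(_ x): no_prog; rewrite xn0 negb_forall.
have KKp : (0 < K < p)%N by rewrite K0 ltnW.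
have n0A' : 0 \notin A' by rewrite setD11.
have n0B' : 0 \notin B' by rewrite setD11.
have := no_progression_bound g_prim zeta_prim (@complex_archimedean R) hp KKp n0A' n0B' x0 wC wE np.
have F1C : (#|F|.-1)%:R = ((q - 1)%:C)%C :> R[i].
  by rewrite rmorphB rmorph1 rmorph_nat -subn1 natrB.
rewrite natrB // sq F1C -(rmorph_nat (real_complex R) K) -(rmorph_nat (real_complex R) K.-1).
rewrite -!rmorphXn -!rmorphM -!rmorphXn /= -rmorphB -(rmorph1 (real_complex R)) -rmorphD.
rewrite -rmorphB -!rmorphM /= lecR => bound.
have : (K.-1%:R * y + 1) * (((y ^+ 2 - 1) * w) ^+ K - (w ^+ 2) ^+ K) <
    (w ^+ 2) ^+ K * (y ^+ 2 - 1 - K%:R).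
  apply: (@density_beats_error _ K a b) => //; rewrite ?sqrtr_ge0 ?y2 //.
  - by rewrite (exprM y 2 2) y2.
  - by rewrite w2 ler_pM // subr_ge0 ltW.
by rewrite y2 ltNge bound.
Qed.
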